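(* Let $n\ge2$. The compact spaces $\mathcal{S}_0$ and $\mathcal{S}_1$ are $h$-equal but not homotopy equivalent.
   Context: Let $\mathcal{S}=S^n$ and $\mathcal{S}^2=S^n\times S^n$. $\mathcal{S}_0=\bigvee_{j\ge1}\mathcal{S}_0(j)$ is a compact (Hawaiian-earring type) wedge in $\mathbb{R}^{2n+2}$ of countably many copies $\mathcal{S}_0(j)$ of $S^n\times S^n$ at a common basepoint $s$ (the origin), the factors meeting pairwise only at $s$ and their diameters tending to $0$, with the subspace topology. $\mathcal{S}_1=\mathcal{S}\vee\mathcal{S}_0$ is the analogous compact wedge $\bigvee_{j\ge1}\mathcal{S}_1(j)$ in $\mathbb{R}^{2n+2}$ in which the first factor $\mathcal{S}_1(1)$ is a copy of $S^n$ and the factors $\mathcal{S}_1(j)$, $j\ge2$, are copies of $S^n\times S^n$. $X=_hY$ ($h$-equal) means there exist maps $f:X\to Y,\ g:Y\to X$ with $g\circ f\simeq\mathrm{id}_X$ and maps $f':Y\to X,\ g':X\to Y$ with $g'\circ f'\simeq\mathrm{id}_Y$. *)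

(* Defs.v *)
From Stdlib Require Import Reals Lra Lia.
Open Scope R_scope.

(* Points of R^d are represented as functions nat -> R; a point of R^d is one
   whose coordinates of index >= d vanish. *)
Definition Rd := nat -> R.

Fixpoint sumsq (d : nat) (f : nat -> R) : R :=
  match d with
  | O => 0
  | S k => sumsq k f + f k ^ 2
  end.

Definition dist (d : nat) (p q : Rd) : R := sqrt (sumsq d (fun i => p i - q i)).

Definition supported (d : nat) (p : Rd) : Prop := forall i, (d <= i)%nat -> p i = 0.

Definition subspace := Rd -> Prop.

Definition continuous_on (d : nat) (A : subspace) (f : Rd -> Rd) : Prop :=
  forall p, A p -> forall eps, 0 < eps -> exists delta, 0 < delta /\
    forall q, A q -> dist d q p < delta -> dist d (f q) (f p) < eps.

Definition is_map (d : nat) (X Y : subspace) (f : Rd -> Rd) : Prop :=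
  (forall p, X p -> Y (f p)) /\ continuous_on d X f.

Definition homotopic (d : nat) (X Y : subspace) (f g : Rd -> Rd) : Prop :=
  exists H : Rd -> R -> Rd,
    (forall p t, X p -> 0 <= t <= 1 -> Y (H p t)) /\
    (forall p t, X p -> 0 <= t <= 1 -> forall eps, 0 < eps ->
       exists delta, 0 < delta /\
       forall q s, X q -> 0 <= s <= 1 -> dist d q p < delta -> Rabs (s - t) < delta ->
         dist d (H q s) (H p t) < eps) /\
    (forall p, X p -> forall i, H p 0 i = f p i /\ H p 1 i = g p i).

Definition dominated (d : nat) (X Y : subspace) : Prop :=
  exists f g, is_map d X Y f /\ is_map d Y X g /\
    homotopic d X X (fun p => g (f p)) (fun p => p).

Definition h_equal (d : nat) (X Y : subspace) : Prop :=
  dominated d X Y /\ dominated d Y X.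

Definition homotopy_equivalent (d : nat) (X Y : subspace) : Prop :=
  exists f g, is_map d X Y f /\ is_map d Y X g /\
    homotopic d X X (fun p => g (f p)) (fun p => p) /\
    homotopic d Y Y (fun p => f (g p)) (fun p => p).

(* The n-sphere of radius r in the block of coordinates o, ..., o+n,
   centered at r * e_o (so it passes through the origin of that block). *)
Definition onSphere (n : nat) (r : R) (o : nat) (p : Rd) : Prop :=
  sumsq (S n) (fun i => p (o + i)%nat - (if Nat.eqb i 0 then r else 0)) = r ^ 2.

(* R^(2n+2) = R^(n+1) x R^(n+1); first block coordinates 0..n, second n+1..2n+1 *)
Definition dimS2 (n : nat) : nat := (2 * n + 2)%nat.

(* S_0: wedge of copies S(r_k) x S(r_k) of S^n x S^n, r_k = 1/(k+2), where
   S(r) is the n-sphere of radius r tangent at 0; distinct copies meet only at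
   the origin, diameters tend to 0, the union is compact. *)
Definition S0 (n : nat) : subspace := fun p =>
  supported (dimS2 n) p /\
  exists k : nat, onSphere n (/ INR (k + 2)) 0 p /\ onSphere n (/ INR (k + 2)) (S n) p.

(* S_1 = S^n v S_0: additionally the n-sphere S(1) x {0}. *)
Definition S1 (n : nat) : subspace := fun p =>
  (supported (S n) p /\ onSphere n 1 0 p) \/ S0 n p.

(* Main.v *)
(** Composites of maps between spheres and the two wedges are studied through a
    mod 2 degree for maps from the torus [T^m] to [R^(m+1)] minus the origin, computed on a
    fine grid as a cup product of sign labels; it is a homotopy invariant by a
    combinatorial prism argument.

    Suppose [f : S0 -> S1] and [g : S1 -> S0] are homotopy inverse. Let [h] be [f]
    followed by the retraction of [S1] onto its sphere, and [a] the restriction of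
    [g] to that sphere. Then [h a] is homotopic to the identity, so it has degree 1.
    On the other hand the degree of [h a] is the sum over the pieces
    [S^n x S^n] of [S0], and then over the two factors (after pinching), of the degrees
    of maps of the form [x |-> h (u x, v)], with [v] fixed. That degree equals the degree
    of [(x, y) |-> (h (u x, y), y)] into [S^n x S^n]. The second component [y] is
    the value of a projection [w] of [S0] onto a sphere, so this map is homotopic,
    because [g f] is homotopic to the identity, to a map factoring through
    [(retraction, w g) : S1 -> S^n x S^n], whose image lies in the union of
    [{pt} x S^n] and the graph of a map; it is not surjective and the degree is 0. *)
Require Import Defs.
From Stdlib Require Import Reals Lra Lia FunctionalExtensionality Classical ClassicalEpsilon.
From mathcomp Require all_boot.
Open Scope R_scope.

(** Neither [f] nor [g] preserves base points. Degrees are therefore counted at a test point that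
    depends on a parameter [tau] in [0,1]; changing [tau] is itself a homotopy and keeps the count.
    Choosing [tau] so that the image of the base point is not the test point makes the sum over the
    infinitely many pieces of [S0] finite: cells near the base point contribute nothing, and by
    compactness the others meet only finitely many pieces. The second parameter of a test pair is
    chosen to put the pair off the graph; the pair is off {pt} x S^n because the first test point is
    never the base point of the sphere. The link between the two is a collapse of the torus onto the
    sphere, of degree 1. *)

Module Degree.
Import Defs all_boot.
Set Implicit Arguments.
Unset Strict Implicit.
Unset Printing Implicit Defensive.

(** * Cup products of labels on a commuting system of shifts *)

Local Open Scope nat_scope.

Notation "\xor_ ( i 'in' A ) F" := (\big[addb/false]_(i in A) F)
  (at level 41, F at level 41, i, A at level 50).
Notation "\xor_ ( i : T ) F" := (\big[addb/false]_(i : T) F)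
  (at level 41, F at level 41, i at level 50).

(** Every unordered pair is counted twice, which is zero mod 2. *)
Lemma xor_symmetric (I : finType) (D : {set I}) (f : I -> I -> bool) :
  (forall i j, f i j = f j i) ->
  \xor_(i in D) \xor_(j in D :\ i) f i j = false.
Proof.
move=> fC; have [m] := ubnP #|D|; elim: m D => // m IH D.
case: (set_0Vmem D) => [->|[a aD]]; first by rewrite big_set0.
rewrite (cardsD1 a) aD add1n ltnS => /IH E.
rewrite (big_setD1 a) //= -[RHS](addbb (\xor_(j in D :\ a) f a j)).
congr addb; rewrite -[RHS]addbF -[X in _ = _ (+) X]E -big_split /=.
apply: eq_bigr => i; rewrite in_setD1 => /andP[ia iD].
rewrite (big_setD1 a) /=; last by rewrite in_setD1 eq_sym ia aD.
by rewrite fC; congr addb; apply: eq_bigl => j; rewrite !inE; case: (j == a); case: (j == i).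
Qed.

Section Cup.
Variables (I : finType) (T : Type) (s : I -> T -> T).

(* The cup product of the coboundaries of the labels [As], evaluated on the cube with
   base vertex [x] and directions [D]: a sum over the monotone edge paths. *)
Fixpoint cup (As : seq (T -> bool)) (D : {set I}) (x : T) : bool :=
  if As is A :: As' then
    \xor_(i in D) ((A x (+) A (s i x)) && cup As' (D :\ i) (s i x))
  else true.

(** [P] is an invariant of the pairs (remaining directions, current vertex) met by the recursion. It
    confines the comparison of labels to the vertices of a single cell, as in [cell_shift_in]. *)
Lemma eq_cup (P : {set I} -> T -> Prop) As As' D x :
  (forall D y i, P D y -> i \in D -> P (D :\ i) (s i y)) ->
  size As = size As' ->
  (forall D y k, P D y -> k < size As ->
    nth xpred0 As k y = nth xpred0 As' k y) ->
  P D x -> cup As D x = cup As' D x.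
Proof.
move=> Ps; elim: As As' D x => [|A As IH] [|A' As'] //= D x [sz] eqA PDx.
apply: eq_bigr => i iD; have PDi := Ps _ _ _ PDx iD.
rewrite (eqA _ _ 0%N PDx isT : A x = A' x) (eqA _ _ 0%N PDi isT : A (s i x) = A' (s i x)).
rewrite (IH As') //.
by move=> E y k; apply: (eqA E y k.+1).
Qed.

Lemma cup_const (P : {set I} -> T -> Prop) As D x k :
  (forall D y i, P D y -> i \in D -> P (D :\ i) (s i y)) ->
  k < size As ->
  (forall D y i, P D y -> i \in D ->
    nth xpred0 As k y = nth xpred0 As k (s i y)) ->
  P D x -> cup As D x = false.
Proof.
move=> Ps; elim: As D x k => [|A As IH] //= D x [|k] ks cA PDx;
  apply: big1 => i iD.
  by rewrite -(cA _ _ _ PDx iD : A x = A (s i x)) addbb.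
by rewrite (IH _ _ k) ?andbF//; apply: Ps PDx iD.
Qed.

Hypothesis sC : forall i j x, s i (s j x) = s j (s i x).

(** A cup product of coboundaries is a cocycle: its values on the faces of a cube, front and back in
    each direction, add up to zero. *)
Lemma cup_cocycle As (D : {set I}) x :
  \xor_(i in D) (cup As (D :\ i) x (+) cup As (D :\ i) (s i x)) = false.
Proof.
elim: As D x => [|A As IH] D x /=; first by rewrite big1.
pose g i j := cup As (D :\ i :\ j) (s i (s j x)).
have gC i j : g i j = g j i by rewrite /g sC !setDDl setUC.
pose k i j := cup As (D :\ i :\ j) (s j x).
(* Splitting off the mixed second difference of [A] leaves two sums. One is symmetric in [i] and [j]
   and cancels in pairs; the other, after exchanging the sums, is the induction hypothesis at
   [s j x]. *)
rewrite (eq_bigr (fun i => (\xor_(j in D :\ i) ((A x (+) A (s j x)) && (k i j (+) g i j)))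
   (+) \xor_(j in D :\ i) ((A x (+) A (s i x) (+) A (s j x) (+) A (s i (s j x))) && g i j))).
  rewrite big_split /= [X in _ (+) X]xor_symmetric ?addbF; last first.
    move=> i j; rewrite gC sC; congr andb.
    by case: (A x); case: (A (s i x)); case: (A (s j x)).
  rewrite (exchange_big_dep (mem D)) /=; last by move=> i j _ /setD1P[].
  apply: big1 => j jD; rewrite -big_distrr /=.
  rewrite (_ : \big[addb/false]_(_ | _) _ = false) ?andbF//.
  rewrite -[RHS](IH (D :\ j) (s j x)); apply: eq_big => [i|i _].
    by rewrite !inE jD andbT eq_sym andbC.
  by rewrite /k /g !setDDl [[set i] :|: _]setUC.
move=> i iD; rewrite -!big_split /=; apply: eq_bigr => j _.
rewrite -!(sC i j) /k /g.
by case: (A x); case: (A (s i x)); case: (A (s j x)); case: (A _);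
  case: (cup _ _ _); case: (cup _ _ _).
Qed.

End Cup.

Lemma cup_embed (I1 I2 : finType) (T1 T2 : Type) (s1 : I1 -> T1 -> T1)
    (s2 : I2 -> T2 -> T2) (u : I1 -> I2) (e : T1 -> T2) As (D : {set I1}) x :
  injective u -> (forall i y, e (s1 i y) = s2 (u i) (e y)) ->
  cup s2 As (u @: D) (e x) = cup s1 [seq A \o e | A <- As] D x.
Proof.
move=> uI eS; elim: As D x => [|A As IH] //= D x.
rewrite big_imset /=; last by move=> ? ? _ _; apply: uI.
apply: eq_bigr => i iD; rewrite -eS -IH; congr (_ && cup _ _ _ _).
apply/setP => j; rewrite !inE; apply/andP/imsetP => [[ji /imsetP[k kD jk]]|[k]].
  by exists k => //; rewrite !inE kD andbT; apply: contra ji => /eqP <-; rewrite jk.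
rewrite !inE => /andP[ki kD] ->; split; last exact: imset_f.
by apply: contra ki => /eqP /uI ->.
Qed.

(* In the prism [T * bool] over [T], [false] is the bottom and [true] the top. *)
Definition prism_shift (I : finType) (T : Type) (s : I -> T -> T) (i : option I)
    (p : T * bool) : T * bool :=
  if i is Some j then (s j p.1, p.2) else (p.1, true).

Definition prism_label (T : Type) (A : (T -> bool) * (T -> bool)) (p : T * bool) :=
  if p.2 then A.2 p.1 else A.1 p.1.

(** The cocycle identity of the prism cubes is weighted by [g0] and summed over all base points. The
    side faces cancel because each [s i] permutes [T]; only bottom and top remain. The guard lets
    the weight [g0 x] be replaced by the weight at the shifted vertex on every face where the cup
    product does not vanish. *)
Lemma xor_cup_homotopy (I T : finType) (s : I -> T -> T)
    (As : seq ((T -> bool) * (T -> bool))) (g0 g1 : T -> bool) :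
  (forall i j x, s i (s j x) = s j (s i x)) -> (forall i, injective (s i)) ->
  (let s' := prism_shift s in let As' := map (@prism_label T) As in
   let g' := prism_label (g0, g1) in
   forall D i x, cup s' As' D (s' i (x, false)) -> g' (s' i (x, false)) = g0 x) ->
  \xor_(x : T) (g0 x && cup s (map fst As) setT x) =
  \xor_(x : T) (g1 x && cup s (map snd As) setT x).
Proof.
move=> sC sI; set s' := prism_shift s; set As' := map _ As.
set g' := prism_label _ => /= guard.
have s'C i j p : s' i (s' j p) = s' j (s' i p).
  by case: i j p => [i|] [j|] [x b] //=; rewrite sC.
have emb b (D : {set I}) x : cup s' As' [set Some i | i in D] (x, b) =
    cup s (map (if b then snd else fst) As) D x.
  rewrite (@cup_embed _ _ _ _ s s' Some (fun y => (y, b))) //; last by move=> ? ? [].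
  by congr cup; rewrite /As' -map_comp; case: b.
have DT : [set: option I] :\ None = [set Some i | i in [set: I]].
  apply/setP => -[i|]; rewrite !inE ?imset_f ?inE //.
  by apply/esym/imsetP => -[].
have E x : \xor_(i in [set: option I]) ((g0 x && cup s' As' (setT :\ i) (x, false))
    (+) (g' (s' i (x, false)) && cup s' As' (setT :\ i) (s' i (x, false)))) = false.
  have := cup_cocycle s'C As' setT (x, false).
  move/(congr1 (andb (g0 x))); rewrite andbF big_distrr /= => E.
  rewrite -[RHS]E; apply: eq_bigr => i _; rewrite andb_addr; congr addb.
  case: (boolP (cup _ _ _ (s' i _))) => [/guard ->|_] //; by rewrite !andbF.
have : \xor_(x : T) \xor_(i in [set: option I])
    ((g0 x && cup s' As' (setT :\ i) (x, false))
    (+) (g' (s' i (x, false)) && cup s' As' (setT :\ i) (s' i (x, false)))) = false.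
  by apply: big1 => x _; apply: E.
rewrite exchange_big /= (bigD1 None) ?inE //= [X in _ (+) X]big1; last first.
  case=> [i _|/andP[]//]; rewrite big_split /= [X in X (+) _](reindex_inj (sI i)) /=.
  by rewrite addbb.
rewrite addbF big_split /= DT => H; apply/eqP.
rewrite -(addbK (\xor_(x : T) (g1 x && cup s (map snd As) setT x)) (\xor_(x : T) (g0 x && _))).
apply/eqP; rewrite -[RHS]addFb; congr addb; rewrite -[RHS]H; congr addb;
  apply: eq_bigr => x _; by rewrite emb.
Qed.

Local Open Scope R_scope.

(** * Continuity and compactness *)

Lemma eq_sumsq d f g : (forall i, (i < d)%N -> f i = g i) -> sumsq d f = sumsq d g.
Proof.
elim: d => //= d IH E; rewrite IH ?E // => i id; apply: E; exact: ltnW.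
Qed.

Lemma sumsq_ge0 d f : 0 <= sumsq d f.
Proof. elim: d => /= [|d IH]; first lra. have := pow2_ge_0 (f d); lra. Qed.

Lemma coord_le_sumsq d f i : (i < d)%N -> f i ^ 2 <= sumsq d f.
Proof.
elim: d => //= d IH; rewrite ltnS leq_eqVlt => /orP[/eqP->|/IH].
  have := sumsq_ge0 d f; lra.
have := pow2_ge_0 (f d); lra.
Qed.

Lemma sumsq_eq0 d f : sumsq d f = 0 -> forall i, (i < d)%N -> f i = 0.
Proof.
move=> E i /(coord_le_sumsq f); rewrite E => H.
have := pow2_ge_0 (f i) => H'.
have : f i ^ 2 = 0 by lra. by move=> /= ?; nra.
Qed.

Lemma sumsq_le d f e : 0 <= e -> (forall i, (i < d)%N -> Rabs (f i) <= e) ->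
  sumsq d f <= (INR d * e) ^ 2.
Proof.
move=> e0; elim: d => [|d IH] H; first by rewrite /=; lra.
rewrite [sumsq _ _]/= S_INR.
have H1 := IH (fun i id => H i (ltnW id)).
have H2 := H d (ltnSn d).
have H3 : f d ^ 2 <= e ^ 2 by apply: pow_maj_Rabs.
have := pos_INR d; nra.
Qed.

Lemma dist_ge0 d p q : 0 <= dist d p q.
Proof. exact: sqrt_pos. Qed.

Lemma coord_le_dist d p q i : (i < d)%N -> Rabs (p i - q i) <= dist d p q.
Proof.
move=> id; rewrite -sqrt_Rsqr_abs; apply: sqrt_le_1_alt.
have := coord_le_sumsq (fun i => p i - q i) id; rewrite /Rsqr /=; lra.
Qed.

Lemma dist_le d p q e : 0 <= e -> (forall i, (i < d)%N -> Rabs (p i - q i) <= e) ->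
  dist d p q <= INR d * e.
Proof.
move=> e0 H; rewrite -(sqrt_pow2 (INR d * e)); last by have := pos_INR d; nra.
by apply: sqrt_le_1_alt; apply: sumsq_le.
Qed.

Lemma dist_eq0 d p q : (forall i, (i < d)%N -> p i = q i) -> dist d p q = 0.
Proof.
move=> H; have := @dist_le d p q 0 (Rle_refl _) => H1.
have : dist d p q <= INR d * 0.
  by apply: H1 => i id; rewrite H // Rminus_diag Rabs_R0; lra.
have := dist_ge0 d p q; lra.
Qed.

Definition cont_at d (P : subspace) (k : Rd -> R) (p : Rd) :=
  forall eps, 0 < eps -> exists delta, 0 < delta /\
    forall q, P q -> dist d q p < delta -> Rabs (k q - k p) < eps.

Definition contr d P k := forall p, P p -> cont_at d P k p.

Section ContAt.
Variables (d : nat) (P : subspace).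
Implicit Types (k : Rd -> R) (p : Rd).

Lemma cont_at_local k k' p delta : 0 < delta ->
  (forall q, P q -> dist d q p < delta -> k q = k' q) -> k p = k' p ->
  cont_at d P k' p -> cont_at d P k p.
Proof.
move=> d0 E Ep C eps /C[e [e0 H]].
exists (Rmin delta e); split; first by apply: Rmin_pos.
move=> q Pq dq; rewrite Ep E //; first last.
  by have := Rmin_l delta e; lra.
by apply: H => //; have := Rmin_r delta e; lra.
Qed.

Lemma cont_at_ext k k' p : P p -> (forall q, P q -> k q = k' q) ->
  cont_at d P k' p -> cont_at d P k p.
Proof. by move=> Pp E; apply: (@cont_at_local _ _ _ 1) => [|q /E //|]; [lra|apply: E]. Qed.

Lemma cont_at_const a p : cont_at d P (fun=> a) p.
Proof. by move=> eps e0; exists 1; split=> [|q _ _]; rewrite ?Rminus_diag ?Rabs_R0; lra. Qed.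

Lemma cont_at_coord i p : (i < d)%N -> cont_at d P (fun q => q i) p.
Proof.
move=> id eps e0; exists eps; split=> // q _; have := coord_le_dist q p id; lra.
Qed.

Lemma cont_at_plus k1 k2 p : cont_at d P k1 p -> cont_at d P k2 p ->
  cont_at d P (fun q => k1 q + k2 q) p.
Proof.
move=> C1 C2 eps e0.
have [d1 [d10 H1]] := C1 (eps / 2) ltac:(lra).
have [d2 [d20 H2]] := C2 (eps / 2) ltac:(lra).
exists (Rmin d1 d2); split; first by apply: Rmin_pos.
move=> q Pq dq; have := Rmin_l d1 d2; have := Rmin_r d1 d2 => m1 m2.
have := H1 q Pq ltac:(lra); have := H2 q Pq ltac:(lra).
move=> A B; apply: Rle_lt_trans (Rplus_lt_compat _ _ _ _ A B) _ || idtac.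
apply: Rle_lt_trans (_ : _ <= Rabs (k1 q - k1 p) + Rabs (k2 q - k2 p)) _; last lra.
apply: Rle_trans (Rabs_triang _ _); apply: Req_le; congr Rabs; ring.
Qed.

Lemma cont_at_comp_real k (h : R -> R) p : cont_at d P k p ->
  continuity_pt h (k p) -> cont_at d P (fun q => h (k q)) p.
Proof.
move=> C H eps e0; have [a [a0 Ha]] := H eps e0.
have [b [b0 Hb]] := C a a0.
exists b; split=> // q Pq dq.
have [->|ne] := Req_dec (k q) (k p); first by rewrite Rminus_diag Rabs_R0.
by apply: (Ha (k q)); split; [split=> // /esym|apply: Hb].
Qed.

Lemma cont_at_scal a k p : cont_at d P k p -> cont_at d P (fun q => a * k q) p.
Proof.
move=> C; apply: (cont_at_comp_real (h := fun x => a * x)) => //.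
by apply: derivable_continuous_pt; apply: derivable_pt_scal; apply: derivable_pt_id.
Qed.

Lemma cont_at_minus k1 k2 p : cont_at d P k1 p -> cont_at d P k2 p ->
  cont_at d P (fun q => k1 q - k2 q) p.
Proof.
move=> C1 C2; have C := cont_at_plus C1 (cont_at_scal (-1) C2).
move=> eps /C[e [e0 H]]; exists e; split=> // q Pq /(H q Pq).
by congr (Rabs _ < _); ring.
Qed.

Lemma cont_at_mult k1 k2 p : cont_at d P k1 p -> cont_at d P k2 p ->
  cont_at d P (fun q => k1 q * k2 q) p.
Proof.
move=> C1 C2.
have sq k : cont_at d P k p -> cont_at d P (fun q => k q * k q) p.
  move=> C; apply: (cont_at_comp_real (h := fun x => x * x)) => //.
  by apply: derivable_continuous_pt; apply: derivable_pt_mult; apply: derivable_pt_id.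
(* Polarization reduces products to squares, hence to composites with a function of one variable. *)
have C := cont_at_scal (/ 4) (cont_at_minus (sq _ (cont_at_plus C1 C2)) (sq _ (cont_at_minus C1 C2))).
move=> eps /C[e [e0 H]]; exists e; split=> // q Pq /(H q Pq).
by congr (Rabs _ < _); field.
Qed.

Lemma cont_at_inv k p : cont_at d P k p -> k p <> 0 -> cont_at d P (fun q => / k q) p.
Proof.
move=> C ne; apply: (cont_at_comp_real (h := Rinv)) => //.
by apply: (continuity_pt_inv id) => //; apply: derivable_continuous_pt; apply: derivable_pt_id.
Qed.

Lemma cont_at_min k1 k2 p : cont_at d P k1 p -> cont_at d P k2 p ->
  cont_at d P (fun q => Rmin (k1 q) (k2 q)) p.
Proof.
move=> C1 C2.
have A : cont_at d P (fun q => Rabs (k1 q - k2 q)) p.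
  by apply: (cont_at_comp_real (h := Rabs)); [apply: cont_at_minus|apply: Rcontinuity_abs].
have C := cont_at_scal (/ 2) (cont_at_minus (cont_at_plus C1 C2) A).
have E a b : / 2 * (a + b - Rabs (a - b)) = Rmin a b.
  by rewrite /Rmin /Rabs; case: Rle_dec; case: Rcase_abs => *; lra.
by move=> eps /C[e [e0 H]]; exists e; split=> // q Pq /(H q Pq); rewrite !E.
Qed.

Lemma cont_at_sumsq m (f : Rd -> Rd) p :
  (forall i, (i < m)%N -> cont_at d P (fun q => f q i) p) ->
  cont_at d P (fun q => sumsq m (f q)) p.
Proof.
elim: m => [|m IH] H; first exact: cont_at_const.
apply: cont_at_plus; first by apply: IH => i im; apply: H; apply: ltnW.
apply: cont_at_mult; first exact: H.
by apply: cont_at_mult; [apply: H|apply: cont_at_const].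
Qed.

Lemma cont_at_dist m (f : Rd -> Rd) p :
  (forall i, (i < m)%N -> cont_at d P (fun q => f q i) p) ->
  forall eps, 0 < eps -> exists delta, 0 < delta /\
    forall q, P q -> dist d q p < delta -> dist m (f q) (f p) < eps.
Proof.
move=> H eps e0.
have C : cont_at d P (fun q => sqrt (sumsq m (fun i => f q i - f p i))) p.
  apply: (cont_at_comp_real (h := sqrt)).
    apply: (cont_at_sumsq (f := fun q i => f q i - f p i)) => i im.
    by apply: cont_at_minus; [apply: H|apply: cont_at_const].
  by apply: continuity_pt_sqrt; apply: sumsq_ge0.
have [e [e00 He]] := C eps e0; exists e; split=> // q Pq dq.
have := He q Pq dq; rewrite -/(dist m (f q) (f p)) -/(dist m (f p) (f p)).
rewrite (dist_eq0 (p := f p) (q := f p)) // Rminus_0_r Rabs_pos_eq //; exact: dist_ge0.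
Qed.

Lemma cont_at_comp d' (X : subspace) (f : Rd -> Rd) k p :
  (forall i, (i < d')%N -> cont_at d P (fun q => f q i) p) ->
  (forall q, P q -> X (f q)) -> cont_at d' X k (f p) ->
  cont_at d P (fun q => k (f q)) p.
Proof.
move=> Cf PX Ck eps /Ck[e [e0 He]].
have [a [a0 Ha]] := cont_at_dist Cf e0.
by exists a; split=> // q Pq dq; apply: He; [apply: PX|apply: Ha].
Qed.

Lemma cont_at_homotopy d' (X : subspace) (H : Rd -> R -> Rd) (f : Rd -> Rd) (t : Rd -> R) p i :
  P p ->
  (forall p t, X p -> 0 <= t <= 1 -> forall eps, 0 < eps ->
       exists delta, 0 < delta /\
       forall q s, X q -> 0 <= s <= 1 -> dist d' q p < delta -> Rabs (s - t) < delta ->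
         dist d' (H q s) (H p t) < eps) ->
  (forall i, (i < d')%N -> cont_at d P (fun q => f q i) p) ->
  (forall q, P q -> X (f q)) -> cont_at d P t p ->
  (forall q, P q -> 0 <= t q <= 1) -> (i < d')%N ->
  cont_at d P (fun q => H (f q) (t q) i) p.
Proof.
move=> Pp CH Cf PX Ct Pt id eps e0.
have [e [e00 He]] := CH _ _ (PX p Pp) (Pt p Pp) eps e0.
have [a [a0 Ha]] := cont_at_dist Cf e00.
have [b [b0 Hb]] := Ct e e00.
exists (Rmin a b); split; first exact: Rmin_pos.
move=> q Pq dq; have := Rmin_l a b; have := Rmin_r a b => m1 m2.
have := coord_le_dist (H (f q) (t q)) (H (f p) (t p)) id.
have := He (f q) (t q) (PX q Pq) (Pt q Pq) (Ha q Pq ltac:(lra)) (Hb q Pq ltac:(lra)).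
lra.
Qed.

End ContAt.

Lemma continuous_on_coord d X f i : continuous_on d X f -> (i < d)%N -> contr d X (fun p => f p i).
Proof.
move=> C id p Xp eps e0; have [e [e00 H]] := C p Xp eps e0.
exists e; split=> // q Xq dq; have := coord_le_dist (f q) (f p) id.
have := H q Xq dq; lra.
Qed.

Lemma coord_continuous_on d X f : (forall i, (i < d)%N -> contr d X (fun p => f p i)) ->
  continuous_on d X f.
Proof. move=> C p Xp eps e0; apply: cont_at_dist => // i id; exact: C. Qed.

(** * Compactness of the cube *)

Definition cube m : subspace := fun x => forall i, (i < m)%N -> 0 <= x i <= 1.

Definition upd (x : Rd) (m : nat) (t : R) : Rd := fun i => if i == m then t else x i.

(** A property inherited by smaller scales takes the place of an open cover. The proof studies the
    supremum of the [a] for which one scale serves all of [0,a]. *)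
Lemma interval_compact (Q : R -> R -> Prop) :
  (forall t a b, Q t a -> 0 < b <= a -> Q t b) ->
  (forall t, 0 <= t <= 1 -> exists e, 0 < e /\
     forall t', 0 <= t' <= 1 -> Rabs (t' - t) < e -> Q t' e) ->
  exists e, 0 < e /\ forall t, 0 <= t <= 1 -> Q t e.
Proof.
move=> Qm H.
pose E a := 0 <= a <= 1 /\ exists e, 0 < e /\ forall t, 0 <= t <= a -> Q t e.
have bE : bound E by exists 1 => a [[]].
have E0 : E 0.
  split; first lra; have [e [e0 He]] := H 0 ltac:(lra).
  exists e; split=> // t t0; have -> : t = 0 by lra.
  by apply: He; rewrite ?Rminus_diag ?Rabs_R0; lra.
have [c [ub lub]] := completeness E bE (ex_intro _ 0 E0).
have c0 : 0 <= c by apply: ub.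
have c1 : c <= 1 by apply: lub => a [[]].
have [e [e0 He]] := H c (conj c0 c1).
have [a [[a01 [e' [e'0 He']]] ac]] : exists a, E a /\ c - e < a.
  apply: NNPP => N; suff : c <= c - e by lra.
  apply: lub => a Ea; apply: Rnot_lt_le => h; apply: N; by exists a.
have L b : 0 <= b <= 1 -> b < c + e -> E b.
  move=> b01 bc; split=> //; exists (Rmin e e'); split; first exact: Rmin_pos.
  have := Rmin_l e e'; have := Rmin_r e e'; have := Rmin_pos _ _ e0 e'0 => m1 m2 m3 t tb.
  have [ta|ta] := Rle_dec t a; first by apply: (Qm _ e') => //; apply: He'; lra.
  apply: (Qm _ e) => //; apply: He; first lra.
  apply: Rabs_def1; lra.
have [ce|ce] := Rle_dec (c + e / 2) 1.
  have := L (c + e / 2) ltac:(lra) ltac:(lra) => /ub; lra.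
by have [_] := L 1 ltac:(lra) ltac:(lra).
Qed.

Lemma cube_compact m (Q : Rd -> R -> Prop) :
  (forall x a b, Q x a -> 0 < b <= a -> Q x b) ->
  (forall x, cube m x -> exists e, 0 < e /\
     forall y, cube m y -> (forall i, (i < m)%N -> Rabs (y i - x i) < e) -> Q y e) ->
  exists e, 0 < e /\ forall x, cube m x -> Q x e.
Proof.
elim: m Q => [|m IH] Q Qm H.
  have [e [e0 He]] := H (fun=> 0) ltac:(by []).
  by exists e; split=> // x cx; apply: He.
pose S t e := forall x, cube m.+1 x -> x m = t -> Q x e.
have [e [e0 He]] : exists e, 0 < e /\ forall t, 0 <= t <= 1 -> S t e.
  apply: interval_compact => [t a b St ab x cx xt|t t01].
    by apply: (Qm x a) => //; apply: St.
  have [x a b Qa ab x01 xt|x cx|e [e0 He]] :=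
    IH (fun x e => 0 <= x m <= 1 -> Rabs (x m - t) < e -> Q x e).
  - apply: (Qm x a) => //; apply: Qa => //; lra.
  - have [|e [e0 He]] := H (upd x m t).
      move=> i; rewrite ltnS leq_eqVlt /upd; case: eqP => //= _; exact: cx.
    exists e; split=> // y cy yx ym yt; apply: He.
      by move=> i; rewrite ltnS leq_eqVlt => /orP[/eqP->|] //; apply: cy.
    move=> i; rewrite ltnS leq_eqVlt /upd; case: eqP => [->|_] //=; exact: yx.
  exists e; split=> // t' t'01 tt x cx xt; apply: He; rewrite ?xt //.
  by move=> i im; apply: cx; apply: ltnW.
exists e; split=> // x cx; apply: (He (x m)) => //; exact: cx.
Qed.

Lemma sup_near_dist m (eps : R) : 0 < eps -> exists e, 0 < e /\ forall p q,
  (forall i, (i < m)%N -> Rabs (q i - p i) < e) -> dist m q p < eps.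
Proof.
move=> e0; have m0 := pos_INR m; exists (eps / (INR m + 1)).
have d0 : 0 < eps / (INR m + 1) by apply: Rdiv_lt_0_compat; lra.
split=> // p q H; apply: Rle_lt_trans (dist_le _ _) _.
- exact: Rlt_le d0.
- by move=> i /H /Rlt_le.
have -> : eps = (INR m + 1) * (eps / (INR m + 1)) by field; lra.
have -> : (INR m + 1) * (eps / (INR m + 1)) / (INR m + 1) = eps / (INR m + 1) by field; lra.
nra.
Qed.

Lemma contr_cube_unif m k : contr m (cube m) k -> forall eps, 0 < eps ->
  exists e, 0 < e /\ forall x y, cube m x -> cube m y ->
    (forall i, (i < m)%N -> Rabs (y i - x i) < e) -> Rabs (k y - k x) < eps.
Proof.
move=> C eps e0.
have [x a b H ab y cy yx|x cx|e [e1 He]] := @cube_compact m (fun x e => forall y, cube m y ->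
    (forall i, (i < m)%N -> Rabs (y i - x i) < e) -> Rabs (k y - k x) < eps); last 1 first.
- by exists e; split=> // x y cx; apply: He.
- apply: H => // i im; have := yx i im; lra.
have [a [a0 Ha]] := C x cx (eps / 2) ltac:(lra).
have [b [b0 Hb]] := @sup_near_dist m a a0.
exists (b / 2); split; first lra.
move=> y cy yx z cz zy.
have H1 : Rabs (k y - k x) < eps / 2.
  apply: Ha => //; apply: Hb => i im; have := yx i im; lra.
have H2 : Rabs (k z - k x) < eps / 2.
  apply: Ha => //; apply: Hb => i im; have := yx i im; have := zy i im.
  have := Rabs_triang (z i - y i) (y i - x i).
  have -> : z i - y i + (y i - x i) = z i - x i by ring.
  lra.
have := Rabs_triang (k z - k x) (k x - k y); rewrite (Rabs_minus_sym (k x)).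
have -> : k z - k x + (k x - k y) = k z - k y by ring.
lra.
Qed.

Lemma contr_cube_max m n (K : nat -> Rd -> R) :
  (forall k, (k <= n)%N -> contr m (cube m) (K k)) ->
  (forall x, cube m x -> exists k, (k <= n)%N /\ K k x <> 0) ->
  exists e, 0 < e /\ forall x, cube m x -> exists k, (k <= n)%N /\ e <= Rabs (K k x).
Proof.
move=> C nz.
have [x a b [k [kn ka]] ab|x cx|e [e1 He]] :=
    @cube_compact m (fun x e => exists k, (k <= n)%N /\ e <= Rabs (K k x)); last 1 first.
- by exists e.
- by exists k; split=> //; lra.
have [k [kn kx]] := nz x cx.
have k0 : 0 < Rabs (K k x) by apply: Rabs_pos_lt.
have [a [a0 Ha]] := C k kn x cx (Rabs (K k x) / 2) ltac:(lra).
have [b [b0 Hb]] := @sup_near_dist m a a0.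
exists (Rmin b (Rabs (K k x) / 2)); split; first by apply: Rmin_pos; lra.
move=> y cy yx; exists k; split=> //.
have H : Rabs (K k y - K k x) < Rabs (K k x) / 2.
  apply: Ha => //; apply: Hb => i im; have := yx i im.
  have := Rmin_l b (Rabs (K k x) / 2); lra.
have := Rmin_r b (Rabs (K k x) / 2).
have := Rabs_triang_inv (K k x) (K k y); rewrite Rabs_minus_sym in H; lra.
Qed.

(** * The degree on a periodic grid *)

Definition posb (r : R) : bool := if Rlt_dec 0 r then true else false.

Lemma posbP r : reflect (0 < r) (posb r).
Proof. by rewrite /posb; case: Rlt_dec => H; constructor. Qed.

Definition labels T (K : seq (T -> R)) : seq (T -> bool) :=
  [seq (fun y => posb (k y)) | k <- K].

(** A discrete intermediate value theorem: some path crosses a sign change of each function in turn.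
    A function is at most [w] in absolute value at its own crossing, and each step back to [x] adds
    at most [w]. *)
Lemma cup_small (I : finType) T (s : I -> T -> T) (K : seq (T -> R)) w (D : {set I}) x :
  0 <= w ->
  (forall k i y, (k < size K)%N ->
    Rabs (nth (fun=> 0) K k (s i y) - nth (fun=> 0) K k y) <= w) ->
  cup s (labels K) D x ->
  forall k, (k < size K)%N -> Rabs (nth (fun=> 0) K k x) <= INR (size K) * w.
Proof.
move=> w0; elim: K D x => [|K Ks IH] D x //= Kw cD k kK.
have [i [iD /andP[Kx cDi]]] : exists i, i \in D /\
    (posb (K x) (+) posb (K (s i x))) && cup s (labels Ks) (D :\ i) (s i x).
  apply: NNPP => N; move: cD; rewrite big1 // => i iD; apply/negP => H; apply: N.
  by exists i.
have s0 := pos_INR (size Ks); rewrite -/(INR (size Ks).+1) S_INR.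
case: k kK => [|k] kK /=.
  suff : Rabs (K x) <= w by nra.
  have := Kw 0%N i x isT; move: Kx => /=.
  case: posbP; case: posbP => //= h1 h2 _; rewrite /Rabs; do 2 case: Rcase_abs => ?; lra.
have H1 := IH _ _ (fun k i y => Kw k.+1 i y) cDi k kK.
have := Kw k.+1 i x kK => /=.
have := Rabs_triang_inv (nth (fun=> 0) Ks k x) (nth (fun=> 0) Ks k (s i x)).
rewrite (Rabs_minus_sym (nth _ Ks k (s i x))); lra.
Qed.

Definition torus m N := {ffun 'I_m -> 'I_N.+1}.

Definition shift m N (i : 'I_m) (x : torus m N) : torus m N :=
  [ffun j => if j == i then ordS (x j) else x j].

Lemma shiftC m N (i j : 'I_m) (x : torus m N) : shift i (shift j x) = shift j (shift i x).
Proof. by apply/ffunP => k; rewrite !ffunE; case: eqP; case: eqP. Qed.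

Lemma shift_inj m N (i : 'I_m) : injective (@shift m N i).
Proof.
move=> x y /ffunP E; apply/ffunP => j; have := E j; rewrite !ffunE.
by case: eqP => // _ /(can_inj (@ordSK _)).
Qed.

Definition cell m N (x y : torus m N) := forall j, y j = x j \/ y j = ordS (x j).

Lemma cell_shift m N (i : 'I_m) (x : torus m N) : cell x (shift i x).
Proof. by move=> j; rewrite ffunE; case: eqP; [right|left]. Qed.

Lemma cell_shift_in m N (x y : torus m N) (D : {set 'I_m}) i :
  (forall j, j \in D -> y j = x j) /\ cell x y -> i \in D ->
  (forall j, j \in D :\ i -> shift i y j = x j) /\ cell x (shift i y).
Proof.
move=> [H1 H2] iD; split=> [j|j]; rewrite ?inE ffunE.
  by move=> /andP[/negbTE ->]; apply: H1.
by case: eqP => [->|_]; [rewrite (H1 i iD); right|apply: H2].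
Qed.

Lemma cup_cell_const m N (As : seq (torus m N -> bool)) x k a :
  (k < size As)%N -> (forall y, cell x y -> nth xpred0 As k y = a) ->
  cup (@shift m N) As setT x = false.
Proof.
move=> ks H; pose P (D : {set 'I_m}) (y : torus m N) := (forall j, j \in D -> y j = x j) /\ cell x y.
apply: (@cup_const _ _ _ P _ _ _ k) => //; first by move=> *; apply: cell_shift_in.
  by move=> D y i PDy iD; rewrite !H //; [case: (cell_shift_in PDy iD)|case: PDy].
by split=> // j; left.
Qed.

Lemma eq_cup_cell m N (As As' : seq (torus m N -> bool)) x :
  size As = size As' ->
  (forall y k, cell x y -> (k < size As)%N -> nth xpred0 As k y = nth xpred0 As' k y) ->
  cup (@shift m N) As setT x = cup (@shift m N) As' setT x.
Proof.
move=> sz H; pose P (D : {set 'I_m}) (y : torus m N) := (forall j, j \in D -> y j = x j) /\ cell x y.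
apply: (@eq_cup _ _ _ P) => //; first by move=> *; apply: cell_shift_in.
  by move=> D y k [_ /H]; apply.
by split=> // j; left.
Qed.

Definition pt m N (x : torus m N) : Rd := fun i =>
  if insub i is Some j then INR (x j) / INR N.+1 else 0.

Lemma pt_cube m N (x : torus m N) : cube m (pt x).
Proof.
move=> i im; rewrite /pt insubT /=; set a := x _; rewrite -/(INR N.+1).
have N0 : 0 < INR N.+1 by apply: lt_0_INR; apply/ltP.
have aN : INR a <= INR N.+1 by apply: le_INR; apply/leP; apply: ltnW; apply: ltn_ord.
have a0 := pos_INR a.
split; first by apply: Rle_mult_inv_pos.
by apply: (Rmult_le_reg_r (INR N.+1)) => //; rewrite Rmult_1_l /Rdiv Rmult_assoc Rinv_l ?Rmult_1_r; lra.
Qed.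

(** Functions on the torus, as functions on the cube that agree on opposite faces. When the
    coordinates below [m] are equal the condition says that [f] ignores all other coordinates, so
    coordinate [m] is free to carry the time of a homotopy. *)
Definition periodic m (X : Type) (f : Rd -> X) := forall x y, cube m x -> cube m y ->
  (forall i, (i < m)%N -> x i = y i \/ (x i = 1 /\ y i = 0)) -> f x = f y.

(* The vertex [y] of the cell at [x], lifted to the cube without wrapping around,
   hence close to [pt x]. *)
Definition lift_pt m N (x y : torus m N) : Rd := fun i =>
  if insub i is Some j then (INR (x j) + (if y j == x j then 0 else 1)) / INR N.+1 else 0.

Lemma lift_pt_cube m N (x y : torus m N) : cube m (lift_pt x y).
Proof.
move=> i im; rewrite /lift_pt insubT /=; set a := x _; set b := (if _ then _ else _); rewrite -/(INR N.+1).
have N0 : 0 < INR N.+1 by apply: lt_0_INR; apply/ltP.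
have aN : INR a + 1 <= INR N.+1.
  by rewrite S_INR; apply: Rplus_le_compat_r; apply: le_INR; apply/leP; rewrite -ltnS; apply: ltn_ord.
have a0 := pos_INR a.
have b01 : 0 <= b <= 1 by rewrite /b; case: ifP => _; lra.
split; first by apply: Rle_mult_inv_pos; lra.
by apply: (Rmult_le_reg_r (INR N.+1)) => //; rewrite Rmult_1_l /Rdiv Rmult_assoc Rinv_l ?Rmult_1_r; lra.
Qed.

Lemma lift_pt_near m N (x y : torus m N) i : (i < m)%N ->
  Rabs (lift_pt x y i - pt x i) <= / INR N.+1.
Proof.
move=> im; rewrite /lift_pt /pt insubT /=; set a := x _; set b := (if _ then _ else _).
have N0 : 0 < INR N.+1 by apply: lt_0_INR; apply/ltP.
rewrite -/(INR N.+1).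
have -> : (INR a + b) / INR N.+1 - INR a / INR N.+1 = b * / INR N.+1 by field; lra.
have := Rinv_0_lt_compat _ N0 => i0.
rewrite /b; case: ifP => _; rewrite ?Rmult_0_l ?Rmult_1_l ?Rabs_R0 ?Rabs_pos_eq; lra.
Qed.

Lemma periodic_lift m N (X : Type) (f : Rd -> X) (x y : torus m N) :
  periodic m f -> cell x y -> f (lift_pt x y) = f (pt y).
Proof.
move=> pf c; apply: pf; [exact: lift_pt_cube|exact: pt_cube|].
move=> i im; rewrite /lift_pt /pt insubT /=; set j := Sub i im; rewrite -/(INR N.+1).
have N0 : 0 < INR N.+1 by apply: lt_0_INR; apply/ltP.
case: eqP => [->|ne]; first by left; rewrite Rplus_0_r.
case: (c j) => // ->.
have := ltn_ord (x j); rewrite ltnS leq_eqVlt => /orP[/eqP E|xN].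
  right; rewrite /ordS /= E modnn; split; last by rewrite /Rdiv Rmult_0_l.
  rewrite -/(INR N.+1) -S_INR; field; lra.
by left; rewrite /ordS /= modn_small // -S_INR.
Qed.

Lemma inv_succ_small e : 0 < e -> exists N0, forall N, (N0 <= N)%N -> / INR N.+1 < e.
Proof.
move=> e0; have [N0 [H1 H2]] := archimed_cor1 e e0.
exists N0 => N NN; apply: Rle_lt_trans H1; apply: Rinv_le_contravar.
  by apply: lt_0_INR.
by apply: le_INR; apply/leP; apply: leqW.
Qed.

Lemma cell_unif m k eps : contr m (cube m) k -> periodic m k -> 0 < eps ->
  exists N0, forall N, (N0 <= N)%N -> forall x y : torus m N, cell x y ->
    Rabs (k (pt y) - k (pt x)) < eps.
Proof.
move=> C pk e0; have [e [e1 He]] := contr_cube_unif C e0.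
have [N0 HN] := inv_succ_small e1; exists N0 => N /HN lN x y c.
rewrite -(periodic_lift pk c); apply: He; [exact: pt_cube|exact: lift_pt_cube|].
by move=> i im; apply: Rle_lt_trans lN; apply: lift_pt_near.
Qed.

(* The mod 2 degree of a map from the torus to [R^(m+1)] minus the origin, with
   components [K 0, ..., K m], computed on a grid: the number of cells where
   [K 0, ..., K (m-1)] all change sign while [K m] is positive. *)
Definition count m N (K : nat -> Rd -> R) : bool :=
  \xor_(x : torus m N) (posb (K m (pt x)) &&
    cup (@shift m N) (labels (mkseq (fun k y => K k (pt y)) m)) setT x).

(** Time is cut with the same mesh as space, and consecutive times bound a prism over the grid. On a
    contributing face the components below [m] are small by [cup_small], so component [m] is large
    and cannot change sign within one step; this is the guard of [xor_cup_homotopy]. *)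
Lemma count_homotopy m (K : nat -> R -> Rd -> R) :
  (forall k, (k <= m)%N -> contr m.+1 (cube m.+1) (fun x => K k (x m) x)) ->
  (forall k t, (k <= m)%N -> 0 <= t <= 1 -> periodic m (K k t)) ->
  (forall t x, 0 <= t <= 1 -> cube m x -> exists k, (k <= m)%N /\ K k t x <> 0) ->
  exists N0, forall N, (N0 <= N)%N ->
    count m N (fun k => K k 0) = count m N (fun k => K k 1).
Proof.
move=> CK pK nz.
have [e [e0 He]] := @contr_cube_max m.+1 m (fun k x => K k (x m) x) CK
  (fun x cx => nz (x m) x (cx m (ltnSn m)) (fun i im => cx i (ltnW im))).
(* With this [w], the bound [m * w] of [cup_small] and the variation [w] of a single step are both
   below [e]. *)
have m0 := pos_INR m; set w := e / (INR m + 2).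
have w0 : 0 < w by apply: Rdiv_lt_0_compat; lra.
have we : e = INR m * w + 2 * w by rewrite /w; field; lra.
have [d [d0 Hd]] : exists d, 0 < d /\ forall k, (k <= m)%N -> forall x y,
    cube m.+1 x -> cube m.+1 y -> (forall i, (i < m.+1)%N -> Rabs (y i - x i) < d) ->
    Rabs (K k (y m) y - K k (x m) x) < w.
  have : forall n, (n <= m.+1)%N -> exists d, 0 < d /\ forall k, (k < n)%N -> forall x y,
    cube m.+1 x -> cube m.+1 y -> (forall i, (i < m.+1)%N -> Rabs (y i - x i) < d) ->
    Rabs (K k (y m) y - K k (x m) x) < w.
    elim=> [_|n IH nm]; first by exists 1; split=> //; lra.
    have [d [d0 Hd]] := IH (ltnW nm).
    have [d' [d'0 Hd']] := contr_cube_unif (CK n nm) w0.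
    exists (Rmin d d'); split; first exact: Rmin_pos.
    move=> k; rewrite ltnS leq_eqVlt => kn x y cx cy xy.
    have m1 := Rmin_l d d'; have m2 := Rmin_r d d'.
    case/orP: kn => [/eqP ->|kn]; [apply: Hd'|apply: Hd] => // i im; have := xy i im; lra.
  by move=> /(_ _ (leqnn _))[d [d0 Hd]]; exists d; split=> // k km; apply: Hd; rewrite ltnS.
have [N0 HN] := inv_succ_small d0; exists N0 => N /HN lN.
have N1 : 0 < INR N.+1 by apply: lt_0_INR; apply/ltP.
pose tm l := INR l / INR N.+1.
have tm01 l : (l <= N.+1)%N -> 0 <= tm l <= 1.
  move=> lN1; have l0 := pos_INR l.
  have := le_INR _ _ (elimT leP lN1) => ll; split; first by apply: Rle_mult_inv_pos.
  by apply: (Rmult_le_reg_r (INR N.+1)) => //; rewrite Rmult_1_l /tm /Rdiv Rmult_assoc Rinv_l; lra.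
have KE k t p : (k <= m)%N -> 0 <= t <= 1 -> cube m p -> K k t (upd p m t) = K k t p.
  move=> km t01 cp; apply: (pK k t km t01) => // i im; rewrite /upd.
    by rewrite ltn_eqF //; apply: cp.
  by rewrite ltn_eqF //; left.
have updc p t : 0 <= t <= 1 -> cube m p -> cube m.+1 (upd p m t).
  by move=> t01 cp i; rewrite ltnS leq_eqVlt /upd; case: eqP => //= _; apply: cp.
have updm p t : upd p m t m = t by rewrite /upd eqxx.
have near k t t' p p' : (k <= m)%N -> 0 <= t <= 1 -> 0 <= t' <= 1 -> cube m p -> cube m p' ->
    (forall i, (i < m)%N -> Rabs (p' i - p i) < d) -> Rabs (t' - t) < d ->
    Rabs (K k t' p' - K k t p) < w.
  move=> km t01 t'01 cp cp' pp tt; rewrite -(KE k t' p') // -(KE k t p) //.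
  rewrite -[X in K k X (upd p' _ _)](updm p') -[X in K k X (upd p _ _)](updm p).
  apply: Hd => //; [exact: updc|exact: updc|move=> i].
  by rewrite ltnS leq_eqVlt /upd; case: eqP => //= _; apply: pp.
have step l : (l < N.+1)%N -> count m N (fun k => K k (tm l)) = count m N (fun k => K k (tm l.+1)).
  move=> lN1; have t01 := tm01 _ (ltnW lN1); have t01' := tm01 _ lN1.
  have tt : Rabs (tm l.+1 - tm l) < d.
    have -> : tm l.+1 - tm l = / INR N.+1 by rewrite /tm [INR l.+1]S_INR; field; lra.
    by rewrite Rabs_pos_eq //; apply: Rlt_le; apply: Rinv_0_lt_compat.
  pose tb (b : bool) := if b then tm l.+1 else tm l.
  have tb01 b : 0 <= tb b <= 1 by case: b.
  pose Kb k (p : torus m N * bool) := K k (tb p.2) (pt p.1).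
  pose As := mkseq (fun k => (fun y : torus m N => posb (K k (tm l) (pt y)),
                              fun y : torus m N => posb (K k (tm l.+1) (pt y)))) m.
  have stepK k i p : (k <= m)%N -> Rabs (Kb k (prism_shift (@shift m N) i p) - Kb k p) <= w.
    move=> km; case: p => x b; case: i => [i|] /=; rewrite /Kb /=.
      rewrite -(periodic_lift (pK _ _ km (tb01 b)) (cell_shift i x)).
      apply: Rlt_le; apply: near => //; [exact: pt_cube|exact: lift_pt_cube| |].
        by move=> j jm; apply: Rle_lt_trans lN; apply: lift_pt_near.
      by rewrite Rminus_diag Rabs_R0.
    apply: Rlt_le; apply: near => //; [exact: pt_cube|exact: pt_cube| |].
      by move=> i _; rewrite Rminus_diag Rabs_R0.
    by case: b => //=; rewrite Rminus_diag Rabs_R0.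
  have EAs : map (@prism_label (torus m N)) As = labels (mkseq Kb m).
    rewrite /labels /As /mkseq -!map_comp; apply: eq_map => k /=.
    by apply: functional_extensionality => -[x []].
  have := @xor_cup_homotopy _ _ (@shift m N) As (fun y => posb (K m (tm l) (pt y)))
     (fun y => posb (K m (tm l.+1) (pt y))) (@shiftC m N) (@shift_inj m N).
  rewrite EAs /count /labels /As /mkseq -!map_comp; apply=> D i x cD.
  set y := prism_shift _ _ _; have sz := size_mkseq Kb m.
  have {}cD : cup (prism_shift (@shift m N)) (labels (mkseq Kb m)) D y.
    by rewrite /labels /mkseq -map_comp.
  have small k : (k < m)%N -> Rabs (Kb k y) <= INR m * w.
    move=> km; have := @cup_small _ _ (prism_shift (@shift m N)) (mkseq Kb m) w D y
      (Rlt_le _ _ w0) _ cD k.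
    rewrite sz nth_mkseq // => H; apply: H km => k' i' z km'.
    by rewrite nth_mkseq //; apply: stepK; apply: ltnW.
  have big : e <= Rabs (Kb m y).
    have [|k [km]] := He (upd (pt y.1) m (tb y.2)); first by apply: updc => //; apply: pt_cube.
    rewrite updm KE //; last exact: pt_cube.
    rewrite -/(Kb k y); move: km; rewrite leq_eqVlt => /orP[/eqP-> //|/small]; lra.
  have := stepK m i (x, false) (leqnn m); rewrite -/y => st.
  have -> : prism_label (fun y => posb (K m (tm l) (pt y)), fun y => posb (K m (tm l.+1) (pt y))) y
     = posb (Kb m y) by rewrite /prism_label /Kb; case: (y.2).
  rewrite -[posb (K m (tm l) (pt x))]/(posb (Kb m (x, false))).
  have mw : 0 <= INR m * w by apply: Rmult_le_pos; lra.
  move: big st; rewrite /posb /Rabs; do 2 case: Rcase_abs => ?; do 2 case: Rlt_dec => ? //; lra.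
have all l : (l <= N.+1)%N -> count m N (fun k => K k (tm 0%N)) = count m N (fun k => K k (tm l)).
  elim: l => [_|l IH lN1]; [reflexivity|exact: etrans (IH (ltnW lN1)) (step l lN1)].
have tm0 : tm 0%N = 0 by rewrite /tm /Rdiv Rmult_0_l.
have tm1 : tm N.+1 = 1 by rewrite /tm; field; lra.
rewrite -[in LHS]tm0 -[in RHS]tm1; exact: all _ (leqnn _).
Qed.

(** * The degree of a map that is the identity on a factor *)

Section Product.
Variables (a n N : nat) (v : 'I_N.+1).
Let T := torus (a + n) N.
Implicit Types (x y : T) (D : {set 'I_(a + n)}).

Definition above (k : 'I_n) (y : torus (a + n) N) : bool := (v < y (rshift a k))%N.

Definition extend (x : torus a N) : torus (a + n) N :=
  [ffun i => match split i with inl j => x j | inr _ => v end].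

Let cross k y := above k y (+) above k (shift (rshift a k) y).

Let above_shift k i y : i != rshift a k -> above k (shift i y) = above k y.
Proof. by rewrite eq_sym /above ffunE => /negbTE ->. Qed.

Let cross_shift k i y : i != rshift a k -> cross k (shift i y) = cross k y.
Proof. by move=> ik; rewrite /cross (shiftC _ i) !(above_shift _ ik). Qed.

Lemma cup_above (ks : seq 'I_n) D y : uniq ks ->
  cup (@shift (a + n) N) [seq above k | k <- ks] D y =
  all (fun k => (rshift a k \in D) && cross k y) ks.
Proof.
elim: ks D y => //= k ks IH D y /andP[kks uks].
have [kD|kD] := boolP (rshift a k \in D); last first.
  rewrite big1 // => i iD; rewrite above_shift ?addbb //.
  by apply: contraNneq kD => <-.
rewrite (bigD1 (rshift a k)) //= big1 ?addbF; last first.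
  by move=> i /andP[_ ik]; rewrite above_shift // addbb.
rewrite IH //; congr andb; apply: eq_in_all => k' k'ks.
have kk' : rshift a k != rshift a k'.
  by apply: contraNneq kks => /(@rshift_inj _ _ _ _) ->.
by rewrite cross_shift // !inE eq_sym kk'.
Qed.

Let ydirs := [set rshift a k | k in 'I_n].

(** The label [above k] changes only along its own direction. A path that spends one of these
    directions on a label of [As] therefore contributes nothing, and the product splits. *)
Lemma cup_cat_above (As : seq (T -> bool)) D y :
  cup (@shift (a + n) N) (As ++ [seq above k | k <- enum 'I_n]) D y =
  all (fun k => (rshift a k \in D) && cross k y) (enum 'I_n) &&
  cup (@shift (a + n) N) As (D :\: ydirs) y.
Proof.
elim: As D y => [|A As IH] D y /=; first by rewrite andbT cup_above ?enum_uniq.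
rewrite (big_setID ydirs) /= big1 ?addFb; last first.
  move=> i; rewrite inE => /andP[iD /imsetP[k _ ik]].
  rewrite IH; set b := all _ _; suff -> : b = false by rewrite andbF.
  by apply/allPn; exists k; rewrite ?mem_enum // !inE ik eqxx.
rewrite big_distrr /=; apply: eq_bigr => i /setDP[iD iy].
have ik k : i != rshift a k by apply: contraNneq iy => ->; apply: imset_f.
rewrite IH andbCA; congr andb.
  by apply: eq_all => k /=; rewrite cross_shift // !inE eq_sym ik.
by congr (_ && cup _ _ _ _); apply/setP => j; rewrite !inE andbCA.
Qed.

Lemma extend_shift (i : 'I_a) (z : torus a N) : extend (shift i z) = shift (lshift n i) (extend z).
Proof.
apply/ffunP => j; rewrite !ffunE; case: (splitP j) => [j' jj'|k jk].
  have -> : j = lshift n j' by apply: val_inj.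
  by rewrite ffunE (inj_eq (@lshift_inj _ _)).
have -> : j = rshift a k by apply: val_inj.
by rewrite eq_sym eq_lrshift.
Qed.

(** On the cycle, [above k] changes between [v] and [v + 1] and again at the wrap from [N] to 0. The
    hypothesis on [N] excludes the wrap, so the contributing cells are those whose last [n]
    coordinates all equal [v]. *)
Lemma xor_cup_product (g : T -> bool) (As Bs : seq (T -> bool)) :
  size Bs = n -> (v < N)%N ->
  (forall x k, g x -> (x (rshift a k) < N)%N) ->
  (forall x y (k : 'I_n), g x -> cell x y -> nth xpred0 Bs k y = above k y) ->
  \xor_(x : T) (g x && cup (@shift (a + n) N) (As ++ Bs) setT x) =
  \xor_(x : torus a N) (g (extend x) &&
    cup (@shift a N) [seq A \o extend | A <- As] setT x).
Proof.
move=> sB vN gN gB.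
pose Q x := [forall k : 'I_n, x (rshift a k) == v].
have E x : g x && cup (@shift (a + n) N) (As ++ Bs) setT x =
    Q x && (g x && cup (@shift (a + n) N) As (setT :\: ydirs) x).
  case: (boolP (g x)) => gx //=; last by rewrite andbF.
  rewrite (@eq_cup_cell _ _ _ (As ++ [seq above k | k <- enum 'I_n])); first last.
  - move=> y k c; rewrite size_cat sB => kAn.
    rewrite !nth_cat; case: (ltnP k (size As)) => // Ak.
    have kn : (k - size As < n)%N by rewrite -(ltn_add2l (size As)) subnKC.
    rewrite (nth_map (Ordinal kn)) ?size_enum_ord //.
    rewrite (nth_ord_enum (Ordinal kn) (Ordinal kn)).
    by rewrite -(gB x y (Ordinal kn)).
  - by rewrite !size_cat sB size_map size_enum_ord.
  rewrite cup_cat_above; congr andb; apply/allP/forallP => H k.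
    have := H k (mem_enum _ k); rewrite inE /= /cross /above ffunE eqxx /ordS /=.
    have := gN x k gx => xN; rewrite modn_small //.
    by rewrite ltnS -val_eqE /= eq_sym; case: ltngtP.
  move=> _; rewrite inE /= /cross /above ffunE eqxx /ordS /= (eqP (H k)) ltnn.
  by rewrite modn_small ?ltnSn.
rewrite (eq_bigr _ (fun x _ => E x)) -big_mkcondl /=.
pose res x : torus a N := [ffun i => x (lshift n i)].
rewrite (reindex_onto extend res) /=; last first.
  move=> x Qx0; have Qx k : x (rshift a k) == v by move: Qx0; rewrite andbT => /forallP/(_ k).
  apply/ffunP => i; rewrite ffunE; case: splitP => [j ij|k ik].
    by rewrite ffunE; congr (x _); apply: val_inj.
  by rewrite -(eqP (Qx k)); congr (x _); apply: val_inj; rewrite /= ik.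
apply: eq_big => [x|x _].
  rewrite [X in _ && X](_ : _ = true) ?andbT; last first.
    by apply/eqP/ffunP => i; rewrite !ffunE (unsplitK (inl i)).
  by apply/forallP => k; rewrite ffunE (unsplitK (inr k)).
congr andb.
have -> : setT :\: ydirs = [set lshift n i | i in [set: 'I_a]].
  apply/setP => i; rewrite !inE andbT; case: (splitP i) => [j ij|k ik].
    have -> : i = lshift n j by apply: val_inj.
    rewrite imset_f ?inE //; apply/imsetP => -[k _ /eqP]; by rewrite eq_lrshift.
  have -> : i = rshift a k by apply: val_inj.
  rewrite imset_f //; apply/esym/imsetP => -[j _ /eqP]; by rewrite eq_rlshift.
apply: cup_embed; [exact: lshift_inj|exact: extend_shift].
Qed.

End Product.

(** * Maps to spheres *)

Definition eventually (P : nat -> Prop) := exists N0, forall N, (N0 <= N)%N -> P N.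

Lemma eventually_and P Q : eventually P -> eventually Q -> eventually (fun N => P N /\ Q N).
Proof.
move=> [a Ha] [b Hb]; exists (maxn a b) => N; rewrite geq_max => /andP[aN bN].
by split; [apply: Ha|apply: Hb].
Qed.

Lemma eventually_mono (P Q : nat -> Prop) : (forall N, P N -> Q N) -> eventually P -> eventually Q.
Proof. by move=> PQ [a Ha]; exists a => N /Ha /PQ. Qed.

Lemma eventually_all n (P : nat -> nat -> Prop) :
  (forall k, (k < n)%N -> eventually (P k)) ->
  eventually (fun N => forall k, (k < n)%N -> P k N).
Proof.
elim: n => [|n IH] H; first by exists 0%N.
have [a Ha] := eventually_and (IH (fun k kn => H k (ltnW kn))) (H n (ltnSn n)).
exists a => N /Ha[H1 H2] k; rewrite ltnS leq_eqVlt => /orP[/eqP -> //|]; exact: H1.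
Qed.

Lemma contr_cube_succ m k : contr m (cube m) k -> contr m.+1 (cube m.+1) k.
Proof.
move=> C x cx.
have cm y : cube m.+1 y -> cube m y by move=> cy i im; apply: cy; apply: ltnW.
apply: (@cont_at_comp _ _ m (cube m) id) => // [i im|]; last by apply: C; apply: cm.
by apply: cont_at_coord; apply: ltnW.
Qed.

(** Lowering the last component until it is negative everywhere never meets the origin, since it is
    already negative where the other components vanish. At the end no cell is counted. *)
Lemma count_avoid m K C :
  (forall k, (k <= m)%N -> contr m (cube m) (K k)) ->
  (forall k, (k <= m)%N -> periodic m (K k)) ->
  (forall x, cube m x -> K m x < C) ->
  (forall x, cube m x -> (forall k, (k < m)%N -> K k x = 0) -> K m x < 0) ->
  eventually (fun N => count m N K = false).
Proof.
move=> CK pK KC av.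
pose H k t x := if k == m then K m x - t * Rmax 0 C else K k x.
have := @count_homotopy m H; case.
- move=> k km x cx; rewrite /H; case: eqP => [_|_]; last by apply: contr_cube_succ => //; apply: CK.
  apply: cont_at_minus; first by apply: contr_cube_succ => //; apply: CK.
  by apply: cont_at_mult; [apply: cont_at_coord|apply: cont_at_const].
- move=> k t km t01 x y cx cy xy; rewrite /H; case: eqP => [_|_]; last exact: pK xy.
  by rewrite (pK m (leqnn m) x y).
- move=> t x t01 cx; apply: NNPP => N.
  have Z k : (k <= m)%N -> H k t x = 0 by move=> km; apply: NNPP => h; apply: N; exists k.
  have := Z m (leqnn m); rewrite /H eqxx => E.
  have := av x cx; have := Rmax_l 0 C => C0 L.
  suff : K m x < 0 by nra.
  by apply: L => k km; have := Z k (ltnW km); rewrite /H ltn_eqF.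
move=> N0 HN; exists N0 => N NN.
have -> : K = H ^~ 0.
  apply: functional_extensionality => k; apply: functional_extensionality => x.
  by rewrite /H; case: eqP => [->|//]; ring.
rewrite HN // /count big1 // => x _; rewrite /H eqxx; case: posbP => // h.
have := KC _ (pt_cube x); have := Rmax_r 0 C; lra.
Qed.

Lemma sumsq_two m f : (forall i, (1 < i < m.+2)%N -> f i = 0) ->
  sumsq m.+2 f = f 0%N ^ 2 + f 1%N ^ 2.
Proof.
elim: m => [|m IH] H; first by rewrite /=; ring.
rewrite -[sumsq m.+3 f]/(sumsq m.+2 f + f m.+2 ^ 2) IH; last first.
  by move=> i /andP[i1 im]; apply: H; rewrite i1 ltnW.
rewrite (H m.+2) ?ltnSn //; ring.
Qed.

Lemma onSphereE n r o p :
  onSphere n r o p <-> sumsq n.+1 (fun i => p (o + i)%N) = 2 * r * p o.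
Proof.
rewrite /onSphere.
have -> : sumsq (S n) (fun i => p (o + i)%coq_nat - (if Nat.eqb i 0 then r else 0)) =
    sumsq n.+1 (fun i => p (o + i)%N) - 2 * r * p o + r ^ 2.
  elim: n => [|n IH]; first by rewrite /= !plusE addn0; ring.
  by rewrite -[LHS]/(sumsq n.+1 _ + _) IH /= !plusE; ring.
split=> ?; lra.
Qed.

Definition sph n (u : Rd) := supported (S n) u /\ onSphere n 1 0 u.

Lemma sphE n u : sph n u <-> (forall i, (n < i)%N -> u i = 0) /\ sumsq n.+1 u = 2 * u 0%N.
Proof.
rewrite /sph onSphereE /supported.
have -> : sumsq n.+1 (fun i => u (0 + i)%N) = sumsq n.+1 u by apply: eq_sumsq.
rewrite Rmult_1_r; split=> -[H ?]; split=> // i h; apply: H; exact/leP.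
Qed.

Lemma sph_bound n u : sph n u -> 0 <= u 0%N <= 2.
Proof.
move=> /sphE[_ E]; have := sumsq_ge0 n.+1 u; have := coord_le_sumsq u (ltn0Sn n).
rewrite E => ? ?; split; nra.
Qed.

Lemma sph0 n u : sph n u -> u 0%N = 0 -> u = fun=> 0.
Proof.
move=> /sphE[s E] u0; apply: functional_extensionality => i.
have [/s //|] := ltnP n i; rewrite -ltnS; apply: sumsq_eq0; rewrite E u0; ring.
Qed.

Lemma sph_zero n : sph n (fun=> 0).
Proof. apply/sphE; split=> //; elim: n => [|n] /=; lra. Qed.

(* Up to the choice of [tau], these components vanish on the sphere exactly at the
   base point and at the point [2 / (1 + tau ^ 2) * (e_0 + tau e_1)]; the last
   component is positive at the latter only. *)
Definition sphK n tau (u : Rd) (k : nat) :=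
  if k == n then u 0%N - 1 / 2 else u k.+1 - (if k == 0%N then tau * u 0%N else 0).

(** At a common zero [u 0] is 0 or 2 / (1 + tau ^ 2), and the latter is at least 1 because [tau] is
    at most 1. The threshold 1 / 2 separates the two for all these [tau] at once. *)
Lemma sphK_nz n tau u : (0 < n)%N -> sph n u -> 0 <= tau <= 1 ->
  (forall k, (k < n)%N -> sphK n tau u k = 0) -> u 0%N <> 1 / 2.
Proof.
move=> n0 /sphE[s E] t01 Z u0.
case: n n0 s E Z => // n _ s E Z.
move: E; rewrite sumsq_two.
  have := Z 0%N isT; rewrite /sphK /= u0 => u1; nra.
move=> [//|i] /andP[i0 im]; have := Z i; rewrite /sphK ltn_eqF // => /(_ im).
by case: i i0 im => //= i _ _; lra.
Qed.

Lemma sphK_center n tau u u' : (0 < n)%N -> sph n u -> sph n u' ->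
  (forall k, (k < n)%N -> sphK n tau u k = 0) -> 0 < u 0%N ->
  (forall k, (k < n)%N -> sphK n tau u' k = 0) -> 0 < u' 0%N -> u = u'.
Proof.
move=> n0 su su' Z u0 Z' u'0.
case: n n0 su su' Z Z' => // n _ su su' Z Z'.
have H w : sph n.+1 w -> (forall k, (k < n.+1)%N -> sphK n.+1 tau w k = 0) -> 0 < w 0%N ->
    (1 + tau ^ 2) * w 0%N = 2 /\ w 1%N = tau * w 0%N /\ (forall i, (1 < i)%N -> w i = 0).
  move=> /sphE[s E] Zw w0; have w1 : w 1%N = tau * w 0%N.
    by have := Zw 0%N isT; rewrite /sphK /=; lra.
  have wi i : (1 < i)%N -> w i = 0.
    case: i => // i i1; have [h|h] := ltnP i n.+1; last exact: s.
    have := Zw i h; rewrite /sphK ltn_eqF //; case: i i1 h => //= i _ _; lra.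
  split=> //; move: E; rewrite sumsq_two ?w1.
    move=> E; apply: (Rmult_eq_reg_r (w 0%N)); nra.
  by move=> i /andP[i1 _]; apply: wi.
have [a [b c]] := H u su Z u0; have [a' [b' c']] := H u' su' Z' u'0.
have E : u 0%N = u' 0%N by apply: (Rmult_eq_reg_l (1 + tau ^ 2)); [rewrite a a'|nra].
apply: functional_extensionality => -[//|[|i]]; first by rewrite b b' E.
by rewrite c ?c'.
Qed.

Definition smap m n (f : Rd -> Rd) :=
  [/\ forall x, cube m x -> sph n (f x),
      forall i, (i < n.+1)%N -> contr m (cube m) (fun x => f x i) & periodic m f].

Definition shom m n (f : R -> Rd -> Rd) :=
  [/\ forall t x, 0 <= t <= 1 -> cube m x -> sph n (f t x),
      forall i, (i < n.+1)%N -> contr m.+1 (cube m.+1) (fun x => f (x m) x i) &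
      forall t, 0 <= t <= 1 -> periodic m (f t)].

Lemma smap_shom m n f : smap m n f -> shom m n (fun=> f).
Proof.
case=> H1 H2 H3; split=> // [t x _|i im]; first exact: H1.
by apply: contr_cube_succ; apply: H2.
Qed.

Definition lerp a b t := (1 - t) * a + t * b.

Lemma lerp01 a b t : 0 <= a <= 1 -> 0 <= b <= 1 -> 0 <= t <= 1 -> 0 <= lerp a b t <= 1.
Proof. rewrite /lerp => *; split; nra. Qed.

Lemma lerp_0 a b : lerp a b 0 = a. Proof. rewrite /lerp; ring. Qed.
Lemma lerp_1 a b : lerp a b 1 = b. Proof. rewrite /lerp; ring. Qed.

Lemma cont_at_lerp d (P : subspace) a b (t : Rd -> R) p :
  cont_at d P t p -> cont_at d P (fun q => lerp a b (t q)) p.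
Proof.
move=> Ct; apply: cont_at_plus; apply: cont_at_mult => //; try exact: cont_at_const.
by apply: cont_at_minus => //; apply: cont_at_const.
Qed.

Lemma cont_at_sphK d (P : subspace) n (tau : Rd -> R) (u : Rd -> Rd) k p : (k <= n)%N ->
  cont_at d P tau p -> (forall i, (i < n.+1)%N -> cont_at d P (fun q => u q i) p) ->
  cont_at d P (fun q => sphK n (tau q) (u q) k) p.
Proof.
move=> kn Ct Cu; rewrite /sphK; case: eqP => [_|/eqP ne].
  by apply: cont_at_minus; [apply: Cu|apply: cont_at_const].
have kn' : (k < n)%N by rewrite ltn_neqAle ne.
apply: cont_at_minus; first exact: Cu.
case: eqP => _; last exact: cont_at_const.
by apply: cont_at_mult => //; apply: Cu.
Qed.

(** The test point moves during the homotopy, with its parameter running linearly from [a] to [b];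
    for a constant homotopy this gives independence of [tau]. *)
Lemma count_sph_homotopy n f a b : (0 < n)%N -> shom n n f ->
  0 <= a <= 1 -> 0 <= b <= 1 -> eventually (fun N =>
    count n N (fun k x => sphK n a (f 0 x) k) = count n N (fun k x => sphK n b (f 1 x) k)).
Proof.
move=> n0 [Sf Cf pf] a01 b01.
have := @count_homotopy n (fun k t x => sphK n (lerp a b t) (f t x) k).
rewrite lerp_0 lerp_1; apply.
- move=> k kn x cx; apply: cont_at_sphK => // [|i im]; last exact: Cf.
  by apply: cont_at_lerp; apply: cont_at_coord.
- by move=> k t kn t01 x y cx cy xy; rewrite (pf t t01 x y).
move=> t x t01 cx; apply: NNPP => N.
have Z k : (k <= n)%N -> sphK n (lerp a b t) (f t x) k = 0.
  by move=> kn; apply: NNPP => h; apply: N; exists k.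
apply: (sphK_nz n0 (Sf t x t01 cx) (lerp01 a01 b01 t01)) => [k /ltnW|]; first exact: Z.
by have := Z n (leqnn n); rewrite /sphK eqxx; lra.
Qed.

(** Tests a map into S^n x S^n at a pair of test points. The minimum is positive exactly when both
    first coordinates exceed 1 / 2, and at a common zero of the other components it cannot vanish,
    by [sphK_nz] for each factor. *)
Definition pairK n a b (u v : Rd) (k : nat) :=
  if k == (n + n)%N then Rmin (u 0%N - 1 / 2) (v 0%N - 1 / 2)
  else if (k < n)%N then sphK n a u k else sphK n b v (k - n)%N.

Lemma pairK_zero n a b u v : (forall k, (k < n + n)%N -> pairK n a b u v k = 0) ->
  (forall k, (k < n)%N -> sphK n a u k = 0) /\ (forall k, (k < n)%N -> sphK n b v k = 0).
Proof.
move=> Z; split=> k kn.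
  have kn' : (k < n + n)%N by apply: ltn_addr.
  by have := Z k kn'; rewrite /pairK ltn_eqF // kn.
have := Z (n + k)%N; rewrite ltn_add2l /pairK eqn_add2l => /(_ kn).
by rewrite ltn_eqF // ltnNge leq_addr addKn.
Qed.

Lemma cont_at_pairK d (P : subspace) n (a b : Rd -> R) (u v : Rd -> Rd) k p : (k <= n + n)%N ->
  cont_at d P a p -> cont_at d P b p ->
  (forall i, (i < n.+1)%N -> cont_at d P (fun q => u q i) p) ->
  (forall i, (i < n.+1)%N -> cont_at d P (fun q => v q i) p) ->
  cont_at d P (fun q => pairK n (a q) (b q) (u q) (v q) k) p.
Proof.
move=> kn Ca Cb Cu Cv; rewrite /pairK; case: eqP => [_|/eqP ne].
  by apply: cont_at_min; apply: cont_at_minus; try exact: cont_at_const; [apply: Cu|apply: Cv].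
case: ltnP => h; apply: cont_at_sphK => //; first exact: ltnW.
by rewrite leq_subLR.
Qed.

Lemma count_pair_homotopy n f g a b a' b' : (0 < n)%N -> shom (n + n) n f -> shom (n + n) n g ->
  0 <= a <= 1 -> 0 <= b <= 1 -> 0 <= a' <= 1 -> 0 <= b' <= 1 -> eventually (fun N =>
    count (n + n) N (fun k x => pairK n a b (f 0 x) (g 0 x) k) =
    count (n + n) N (fun k x => pairK n a' b' (f 1 x) (g 1 x) k)).
Proof.
move=> n0 [Sf Cf pf] [Sg Cg pg] a01 b01 a'01 b'01.
have := @count_homotopy (n + n)
  (fun k t x => pairK n (lerp a a' t) (lerp b b' t) (f t x) (g t x) k).
rewrite !lerp_0 !lerp_1; apply.
- move=> k kn x cx; apply: cont_at_pairK => // [||i im|i im]; first 2 last.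
  + exact: Cf.
  + exact: Cg.
  + by apply: cont_at_lerp; apply: cont_at_coord.
  + by apply: cont_at_lerp; apply: cont_at_coord.
- by move=> k t kn t01 x y cx cy xy; rewrite (pf t t01 x y) // (pg t t01 x y).
move=> t x t01 cx; apply: NNPP => N.
have Z k : (k <= n + n)%N -> pairK n (lerp a a' t) (lerp b b' t) (f t x) (g t x) k = 0.
  by move=> kn; apply: NNPP => h; apply: N; exists k.
have [Z1 Z2] := pairK_zero (fun k kn => Z k (ltnW kn)).
have h1 := sphK_nz n0 (Sf t x t01 cx) (lerp01 a01 a'01 t01) Z1.
have h2 := sphK_nz n0 (Sg t x t01 cx) (lerp01 b01 b'01 t01) Z2.
have := Z _ (leqnn _); rewrite /pairK eqxx /Rmin; case: Rle_dec => _ E; lra.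
Qed.

Lemma count_pair_avoid n f g a b : smap (n + n) n f -> smap (n + n) n g ->
  (forall x, cube (n + n) x -> (forall k, (k < n)%N -> sphK n a (f x) k = 0) -> 1 / 2 <= f x 0%N ->
    (forall k, (k < n)%N -> sphK n b (g x) k = 0) -> 1 / 2 <= g x 0%N -> False) ->
  eventually (fun N => count (n + n) N (fun k x => pairK n a b (f x) (g x) k) = false).
Proof.
(* First coordinates on the sphere are at most 2, so the last component is at most 3 / 2. *)
move=> [Sf Cf pf] [Sg Cg pg] av; apply: (@count_avoid _ _ 2).
- move=> k kn x cx; apply: cont_at_pairK => //; try exact: cont_at_const; move=> i im;
    [exact: Cf|exact: Cg].
- by move=> k kn x y cx cy xy; rewrite (pf x y) // (pg x y).
- move=> x cx; rewrite /pairK eqxx.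
  have := sph_bound (Sf x cx); have := Rmin_l (f x 0%N - 1 / 2) (g x 0%N - 1 / 2); lra.
move=> x cx /pairK_zero[Z1 Z2]; apply: Rnot_le_lt => h; apply: (av x cx) => //.
  move: h; rewrite /pairK eqxx; have := Rmin_l (f x 0%N - 1 / 2) (g x 0%N - 1 / 2); lra.
move: h; rewrite /pairK eqxx; have := Rmin_r (f x 0%N - 1 / 2) (g x 0%N - 1 / 2); lra.
Qed.

(** * The collapse of the torus onto the sphere *)

(* The intersection of the line through [v] with the sphere of radius 1 centered
   at [e_0], other than the origin. *)
Definition proj n (v : Rd) : Rd := fun i => 2 * v 0%N * v i / sumsq n.+1 v.

Lemma sumsq_scal d a f : sumsq d (fun i => a * f i) = a ^ 2 * sumsq d f.
Proof. elim: d => [|d IH] /=; first ring. rewrite IH; ring. Qed.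

Lemma sumsq_one m f : (forall i, f i.+1 = 0) -> sumsq m.+1 f = f 0%N ^ 2.
Proof.
move=> Z; elim: m => [|m IH]; first by rewrite /=; ring.
rewrite -[sumsq m.+2 f]/(sumsq m.+1 f + f m.+1 ^ 2) IH Z; ring.
Qed.

Lemma proj_sph n v : (forall i, (n < i)%N -> v i = 0) -> 0 < sumsq n.+1 v -> sph n (proj n v).
Proof.
move=> s v0; apply/sphE; split=> [i /s vi|]; first by rewrite /proj vi /Rdiv; ring.
have -> : sumsq n.+1 (proj n v) = sumsq n.+1 (fun i => (2 * v 0%N / sumsq n.+1 v) * v i).
  by apply: eq_sumsq => i _; rewrite /proj /Rdiv; ring.
rewrite sumsq_scal /proj; field; lra.
Qed.

Lemma cont_at_proj n d (P : subspace) (v : Rd -> Rd) p i : (i < n.+1)%N ->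
  (forall i, (i < n.+1)%N -> cont_at d P (fun q => v q i) p) -> 0 < sumsq n.+1 (v p) ->
  cont_at d P (fun q => proj n (v q) i) p.
Proof.
move=> im Cv v0; apply: cont_at_mult.
  by apply: cont_at_mult; [apply: cont_at_scal; apply: Cv|apply: Cv].
by apply: cont_at_inv; [apply: cont_at_sumsq|lra].
Qed.

Fixpoint bump n (x : Rd) : R := if n is k.+1 then bump k x * (x k * (1 - x k)) else 1.

(** [bump] vanishes on the boundary of the cube, where the direction is thus tangent to the sphere
    at the origin and [proj] returns the base point. The vector is never zero: if all [2 * x k - 1]
    vanish, [bump] is positive. *)
Definition collapse_dir n (x : Rd) : Rd := fun i =>
  if i is k.+1 then (if (k < n)%N then 2 * x k - 1 else 0) else bump n x.

Definition collapse n (x : Rd) : Rd := proj n (collapse_dir n x).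

Lemma bump_ge0 n x : cube n x -> 0 <= bump n x.
Proof.
elim: n => [|n IH] cx /=; first lra.
have := IH (fun i im => cx i (ltnW im)); have := cx n (ltnSn n) => ? ?.
by apply: Rmult_le_pos => //; apply: Rmult_le_pos; lra.
Qed.

Lemma bump_gt0 n x : (forall i, (i < n)%N -> 0 < x i < 1) -> 0 < bump n x.
Proof.
elim: n => [|n IH] cx /=; first lra.
have := IH (fun i im => cx i (ltnW im)); have := cx n (ltnSn n) => ? ?.
by apply: Rmult_lt_0_compat => //; apply: Rmult_lt_0_compat; lra.
Qed.

Lemma bump_eq0 n x k : (k < n)%N -> x k * (1 - x k) = 0 -> bump n x = 0.
Proof.
move=> kn E; elim: n kn => //= n IH; rewrite ltnS leq_eqVlt => /orP[/eqP <-|/IH ->].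
  by rewrite E Rmult_0_r.
by rewrite Rmult_0_l.
Qed.

Lemma bump_interior n x k : cube n x -> (k < n)%N -> 0 < bump n x -> 0 < x k < 1.
Proof.
move=> cx kn b0; have := cx k kn => xk.
have [E|ne] := Req_dec (x k * (1 - x k)) 0; first by have := bump_eq0 kn E; lra.
split; apply: Rnot_le_lt => h; apply: ne.
  have -> : x k = 0 by lra. ring.
have -> : x k = 1 by lra. ring.
Qed.

Lemma eq_bump n x y : (forall i, (i < n)%N -> x i = y i) -> bump n x = bump n y.
Proof. elim: n => //= n IH E; rewrite IH ?E // => i im; apply: E; exact: ltnW. Qed.

Lemma collapse_dir_gt0 n x : 0 < sumsq n.+1 (collapse_dir n x).
Proof.
have h := sumsq_ge0 n.+1 (collapse_dir n x).
apply: Rnot_le_lt => h'; have E : sumsq n.+1 (collapse_dir n x) = 0 by lra.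
have := sumsq_eq0 E => Z.
have : 0 < bump n x.
  apply: bump_gt0 => i im; have := Z i.+1; rewrite ltnS /= im => /(_ isT); lra.
by have := Z 0%N isT => /= ->; lra.
Qed.

Lemma collapse_sph n x : sph n (collapse n x).
Proof.
apply: proj_sph (collapse_dir_gt0 n x) => -[//|i]; rewrite ltnS /= => ni.
by rewrite ltnNge ni.
Qed.

Lemma cont_at_bump d (P : subspace) n (f : Rd -> Rd) p :
  (forall i, (i < n)%N -> cont_at d P (fun q => f q i) p) ->
  cont_at d P (fun q => bump n (f q)) p.
Proof.
elim: n => [|n IH] C; first exact: cont_at_const.
apply: cont_at_mult; first by apply: IH => i im; apply: C; apply: ltnW.
apply: cont_at_mult; first exact: C.
by apply: cont_at_minus; [apply: cont_at_const|apply: C].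
Qed.

Lemma cont_at_collapse d (P : subspace) n (f : Rd -> Rd) p i : (i < n.+1)%N ->
  (forall i, (i < n)%N -> cont_at d P (fun q => f q i) p) ->
  cont_at d P (fun q => collapse n (f q) i) p.
Proof.
move=> im C; apply: cont_at_proj => //; last exact: collapse_dir_gt0.
move=> [_|k]; first exact: cont_at_bump.
rewrite ltnS /= => kn; rewrite kn.
by apply: cont_at_minus; [apply: cont_at_scal; apply: C|apply: cont_at_const].
Qed.

Lemma collapse_boundary n x k : (k < n)%N -> x k * (1 - x k) = 0 -> collapse n x = fun=> 0.
Proof.
move=> kn E; apply: functional_extensionality => i.
by rewrite /collapse /proj /= (bump_eq0 kn E) /Rdiv; ring.
Qed.

Lemma periodic_collapse n : periodic n (collapse n).
Proof.
move=> x y cx cy xy.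
have [[k [kn [x1 y0]]]|N] := classic (exists k, (k < n)%N /\ x k = 1 /\ y k = 0).
  by rewrite (@collapse_boundary n x k) ?(@collapse_boundary n y k) ?x1 ?y0 //; ring.
have E i : (i < n)%N -> x i = y i.
  by move=> im; case: (xy i im) => // h; case: N; exists i.
rewrite /collapse; suff -> : collapse_dir n x = collapse_dir n y by [].
apply: functional_extensionality => -[|i] /=; first exact: eq_bump.
by case: ifP => // /E ->.
Qed.

Definition pole : Rd := fun i => if i == 0%N then 2 else 0.

Lemma collapse_center n x : (forall i, (i < n)%N -> x i = 1 / 2) -> collapse n x = pole.
Proof.
move=> E; have b0 : 0 < bump n x by apply: bump_gt0 => i /E ->; lra.
have Z i : collapse_dir n x i.+1 = 0 by rewrite /=; case: ifP => // /E ->; lra.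
have S : sumsq n.+1 (collapse_dir n x) = bump n x ^ 2 by rewrite sumsq_one.
apply: functional_extensionality => -[|i]; rewrite /collapse /proj S /pole.
  by rewrite /=; field; lra.
rewrite Z /=; field; lra.
Qed.

(** Identifies the sign labels of the collapse with the labels [above] of the product computation,
    the threshold [v] being the midpoint. *)
Lemma collapse_pos n x k : (k < n)%N -> 0 < bump n x -> (0 < collapse n x k.+1 <-> 1 / 2 < x k).
Proof.
move=> kn b0; have S := collapse_dir_gt0 n x; rewrite /collapse /proj /= -/(sumsq n.+1 _) kn.
have -> : 2 * bump n x * (2 * x k - 1) / sumsq n.+1 (collapse_dir n x) =
  (4 * bump n x / sumsq n.+1 (collapse_dir n x)) * (x k - 1 / 2) by field; lra.
have : 0 < 4 * bump n x / sumsq n.+1 (collapse_dir n x) by apply: Rdiv_lt_0_compat; lra.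
split=> h; nra.
Qed.

Lemma collapse_pos0 n x : cube n x -> 0 < collapse n x 0%N -> 0 < bump n x.
Proof.
move=> /bump_ge0 [//|E]; rewrite /collapse /proj /= -E /Rdiv; lra.
Qed.

Lemma smap_collapse n : smap n n (collapse n).
Proof.
split=> [x _|i im x cx|]; [exact: collapse_sph| |exact: periodic_collapse].
by apply: cont_at_collapse => // k kn; apply: cont_at_coord.
Qed.

Lemma sph_proj n u : (0 < n)%N -> sph n u -> exists v : Rd,
  [/\ forall i, (n < i)%N -> v i = 0, 0 <= v 0%N, 0 < sumsq n.+1 v & proj n v = u].
Proof.
move=> n0 su; have [u0|ne] := Req_dec (u 0%N) 0.
  (* The base point comes from the tangent directions, for instance [e_1]. *)
  exists (fun i => if i == 1%N then 1 else 0); split=> //.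
  - by move=> i ni; case: eqP => // i1; move: ni; rewrite i1 ltnNge n0.
  - by rewrite /=; lra.
  - have := @coord_le_sumsq n.+1 (fun i => if i == 1%N then 1 else 0) 1%N n0.
    by rewrite /=; lra.
  rewrite (sph0 su u0); apply: functional_extensionality => i; rewrite /proj /Rdiv /=; ring.
have [s E] := proj1 (sphE n u) su; have b := sph_bound su.
exists u; split=> //; try lra.
apply: functional_extensionality => i; rewrite /proj E; field; lra.
Qed.

(** The directions are interpolated linearly from [e_0]. Their coordinate 0 is positive before time
    1, so they never vanish, and [proj] turns them into a path on the sphere. *)
Lemma sph_path n u : (0 < n)%N -> sph n u -> exists g : R -> Rd,
  [/\ forall t, 0 <= t <= 1 -> sph n (g t),
      forall d (P : subspace) t p i, (i < n.+1)%N -> 0 <= t p <= 1 -> cont_at d P t p ->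
        cont_at d P (fun q => g (t q) i) p,
      g 0 = pole & g 1 = u].
Proof.
move=> n0 su; have [v [vs v0 vp vu]] := sph_proj n0 su.
pose e : Rd := fun i => if i == 0%N then 1 else 0.
pose w t : Rd := fun i => lerp (e i) (v i) t.
have wp t : 0 <= t <= 1 -> 0 < sumsq n.+1 (w t).
  move=> t01; have [->|t1] := Req_dec t 1.
    by have -> : sumsq n.+1 (w 1) = sumsq n.+1 v by apply: eq_sumsq => i _; rewrite /w lerp_1.
  apply: Rlt_le_trans (coord_le_sumsq (w t) (ltn0Sn n)).
  have tv : 0 <= t * v 0%N by apply: Rmult_le_pos; lra.
  by apply: pow_lt; rewrite /w /lerp /e /=; lra.
exists (fun t => proj n (w t)); split.
- move=> t t01; apply: proj_sph (wp t t01) => i ni; rewrite /w /e vs // /lerp.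
  by case: i ni => // i _ /=; ring.
- move=> d P t p i im t01 Ct; apply: cont_at_proj => //; last exact: wp.
  by move=> j _; apply: cont_at_lerp.
- have S : sumsq n.+1 (w 0) = 1.
    by rewrite sumsq_one => [|i]; rewrite /w lerp_0 /e /=; ring.
  apply: functional_extensionality => i; rewrite /proj S /w !lerp_0 /e /pole /=.
  by case: eqP => _; field.
have -> : w 1 = v by apply: functional_extensionality => i; rewrite /w lerp_1.
exact: vu.
Qed.

Definition tail a (x : Rd) : Rd := fun i => x (a + i)%N.

Definition with_center a n (x : Rd) : Rd := fun i =>
  if (i < a)%N then x i else if (i < a + n)%N then 1 / 2 else 0.

Lemma eq_count m N K K' : (forall k x, (k <= m)%N -> cube m x -> K k x = K' k x) ->
  count m N K = count m N K'.
Proof.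
move=> E; apply: eq_bigr => x _; rewrite E //; last exact: pt_cube.
congr (_ && cup _ _ _ _); rewrite /labels /mkseq -!map_comp; apply/eq_in_map => k.
rewrite mem_iota /= => km; apply: functional_extensionality => y /=.
by rewrite E //; [apply: ltnW|apply: pt_cube].
Qed.

Lemma cube_tail a n x : cube (a + n) x -> cube n (tail a x).
Proof. by move=> cx i im; apply: cx; rewrite ltn_add2l. Qed.

Lemma periodic_tail a n X (f : Rd -> X) : periodic n f -> periodic (a + n) (fun x => f (tail a x)).
Proof.
move=> pf x y cx cy xy; apply: pf; try exact: cube_tail.
by move=> i im; apply: xy; rewrite ltn_add2l.
Qed.

Lemma eventually_odd P : eventually P -> eventually (fun M => P M.*2.+1).
Proof.
move=> [N0 H]; exists N0 => M NM; apply: H.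
by apply: leq_trans NM _; rewrite -addnn; apply: leqW; apply: leq_addr.
Qed.

(* The grid has an even number [2 M + 2] of steps, so that the preimage of the pole
   is a grid point. *)
Lemma count_collapse_product a n (K : nat -> Rd -> R) (g : Rd -> R) :
  (forall x, cube (a + n) x ->
     (0 < K (a + n)%N x <-> 0 < g x /\ 1 / 2 < collapse n (tail a x) 0%N)) ->
  (forall k x, (k < n)%N -> cube (a + n) x ->
     K (a + k)%N x = collapse n (tail a x) k.+1) ->
  eventually (fun M => count (a + n) M.*2.+1 K =
    count a M.*2.+1 (fun k x => if k == a then g (with_center a n x) else K k (with_center a n x))).
Proof.
move=> Kg Kl.
have C : contr (a + n) (cube (a + n)) (fun x => collapse n (tail a x) 0%N).
  by move=> x cx; apply: cont_at_collapse => // i im; apply: cont_at_coord; rewrite ltn_add2l.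
have pC : periodic (a + n) (fun x => collapse n (tail a x) 0%N).
  apply: (periodic_tail (f := fun x => collapse n x 0%N)) => x y cx cy xy.
  by rewrite (periodic_collapse cx cy xy).
(* A variation below 1 / 2 keeps coordinate 0 of the collapse positive on every cell where it
   exceeds 1 / 2 at the base vertex. Such cells lie in the interior of the cube in the last [n]
   coordinates. *)
have [N0 HN] := eventually_odd (cell_unif C pC (ltac:(lra) : 0 < 1 / 2)).
exists N0.+1 => M NM; have {HN NM}[HN M0] := conj (HN M (ltnW NM)) (leq_trans (ltn0Sn N0) NM).
set N := M.*2.+1 in HN *.
have MN : (M.+1 < N.+1)%N by rewrite /N !ltnS -addnn leq_addr.
pose v : 'I_N.+1 := Ordinal MN.
have N1 : 0 < INR N.+1 by apply: lt_0_INR; apply/ltP.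
have vE : INR v / INR N.+1 = 1 / 2.
  have -> : INR N.+1 = INR M.+1 * 2 by rewrite -[2]/(INR 2) -mult_INR; congr INR; rewrite multE muln2.
  have -> : INR v = INR M.+1 by [].
  rewrite S_INR; have := pos_INR M => ?; field; lra.
have ptE (x : torus a N) : pt (extend n v x) = with_center a n (pt x).
  apply: functional_extensionality => i; rewrite /with_center /pt.
  case: (ltnP i (a + n)) => ian; last first.
    rewrite insubF; last by apply/negbTE; rewrite -leqNgt.
    by rewrite ltnNge (leq_trans (leq_addr n a) ian).
  rewrite insubT ffunE; case: splitP => /= [j ->|k ->].
    by rewrite ltn_ord; case: insubP => [j' _ /val_inj ->|] //; rewrite ltn_ord.
  by rewrite ltnNge leq_addr.
have inner (x y : torus (a + n) N) : posb (K (a + n)%N (pt x)) -> cell x y ->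
    0 < bump n (tail a (pt y)).
  move=> /posbP /(Kg _ (pt_cube x))[_ gx] /HN.
  move=> h; apply: collapse_pos0; first by apply: cube_tail; apply: pt_cube.
  by move: h; rewrite /Rabs; case: Rcase_abs => ?; lra.
have ptr (y : torus (a + n) N) (k : 'I_n) : tail a (pt y) k = INR (y (rshift a k)) / INR N.+1.
  have h : (a + k < a + n)%N by rewrite ltn_add2l.
  rewrite /tail /pt (insubT (fun i => (i < a + n)%N) h); congr (INR (y _) / _); exact: val_inj.
rewrite /count.
have -> : labels (mkseq (fun k y => K k (pt y)) (a + n)) =
    labels (mkseq (fun k (y : torus (a + n) N) => K k (pt y)) a) ++
    labels (mkseq (fun k (y : torus (a + n) N) => K (a + k)%N (pt y)) n).
  rewrite /labels /mkseq iotaD map_cat map_cat add0n; congr cat.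
  have -> : iota a n = map (addn a) (iota 0 n) by rewrite -iotaDl addn0.
  by rewrite -!map_comp.
rewrite (@xor_cup_product a n N v).
- apply: eq_bigr => x _; rewrite eqxx -ptE; congr andb.
    apply/posbP/posbP => [/(Kg _ (pt_cube _))[]//|gx].
    apply/(Kg _ (pt_cube _)); split=> //; rewrite collapse_center; first by rewrite /pole /=; lra.
    move=> i im; rewrite (ptr _ (Ordinal im)) ffunE (unsplitK (inr _)); exact: vE.
  congr cup; rewrite /labels /mkseq -!map_comp; apply/eq_in_map => k.
  rewrite mem_iota /= => ka; rewrite ltn_eqF //; apply: functional_extensionality => y /=.
  by rewrite ptE.
- by rewrite size_map size_mkseq.
- by rewrite /= /N ltnS -addnn -[X in (X < _)%N]add0n ltn_add2r.
(* A coordinate equal to [N] would be shifted to 0, onto the boundary, where [bump] vanishes,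
   contrary to [inner]. *)
- move=> x k gx; rewrite ltn_neqAle -ltnS ltn_ord andbT; apply/eqP => E.
  have := inner x (shift (rshift a k) x) gx (cell_shift _ _).
  move=> /(bump_interior (cube_tail (pt_cube _)) (ltn_ord k)); rewrite ptr ffunE eqxx /ordS /= E modnn.
  rewrite /= /Rdiv; lra.
move=> x y k gx c; rewrite (nth_map (fun=> 0)) ?size_mkseq // nth_mkseq //.
rewrite Kl //; last exact: pt_cube.
have b0 := inner x y gx c.
have := collapse_pos (ltn_ord k) b0; rewrite ptr -vE => -[H1 H2].
rewrite /above; apply/posbP/idP.
  move=> /H1 h; rewrite ltnNge; apply/negP => /leP /le_INR h'.
  have := Rmult_le_compat_r _ _ _ (Rlt_le _ _ (Rinv_0_lt_compat _ N1)) h'; rewrite -!/(Rdiv _ _); lra.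
move=> /ltP /lt_INR h; apply: H2; apply: Rmult_lt_compat_r => //; exact: Rinv_0_lt_compat.
Qed.

(** * Maps from products of spheres *)

Definition cell_term m N (K : nat -> Rd -> R) (x : torus m N) : bool :=
  posb (K m (pt x)) && cup (@shift m N) (labels (mkseq (fun k y => K k (pt y)) m)) setT x.

Lemma countE m N K : count m N K = \xor_(x : torus m N) cell_term K x.
Proof. by []. Qed.

Lemma eq_cell_term m N K K' (x : torus m N) :
  (forall k y, (k <= m)%N -> cell x y -> K k (pt y) = K' k (pt y)) ->
  cell_term K x = cell_term K' x.
Proof.
move=> E; rewrite /cell_term E //; last by left.
congr andb; apply: eq_cup_cell; first by rewrite !size_map.
move=> y k c; rewrite size_map size_mkseq => km.
by rewrite !(nth_map (fun=> 0)) ?size_mkseq // !nth_mkseq // E // ltnW.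
Qed.

Lemma cell_term_const m N K (x : torus m N) k a : (k < m)%N ->
  (forall y, cell x y -> posb (K k (pt y)) = a) -> cell_term K x = false.
Proof.
move=> km H; rewrite /cell_term (@cup_cell_const _ _ _ _ k a) ?andbF //.
  by rewrite size_map size_mkseq.
by move=> y c; rewrite (nth_map (fun=> 0)) ?size_mkseq // nth_mkseq // H.
Qed.

(** The case [a = 0] of the product computation: the remaining torus is a single point, whose empty
    cup product is true. For [tau = 0] the components are exactly the coordinates of the
    collapse. *)
Lemma count_collapse n : (0 < n)%N -> eventually (fun M =>
  count n M.*2.+1 (fun k x => sphK n 0 (collapse n x) k) = true).
Proof.
move=> n0.
have := @count_collapse_product 0 n (fun k x => sphK n 0 (collapse n x) k) (fun=> 1).
case.
- move=> x _; rewrite /sphK eqxx /=; split=> [?|[_ ?]]; first split.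
  + lra.
  + change (tail 0 x) with x; lra.
  + change (tail 0 x) with x in *; lra.
- move=> k x kn _; rewrite /sphK add0n ltn_eqF //; change (tail 0 x) with x.
  by case: eqP => _; ring.
move=> M0 HM; exists M0 => M /HM ->.
have all_eq (x y : torus 0 M.*2.+1) : x = y by apply/ffunP => -[].
rewrite /count (bigD1 [ffun => ord0]) //= big1.
  by rewrite addbF andbT; apply/posbP; lra.
by move=> x; rewrite (all_eq x [ffun => ord0]) eqxx.
Qed.

Lemma count_sph_tau n f a b : (0 < n)%N -> smap n n f -> 0 <= a <= 1 -> 0 <= b <= 1 ->
  eventually (fun N => count n N (fun k x => sphK n a (f x) k) = count n N (fun k x => sphK n b (f x) k)).
Proof. by move=> n0 /smap_shom sf a01 b01; apply: count_sph_homotopy n0 sf a01 b01. Qed.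

(* Joint continuity of a map from the product of two spheres to a sphere, in terms
   of compositions. *)
Definition bimap n (B : Rd -> Rd -> Rd) :=
  (forall u v, sph n u -> sph n v -> sph n (B u v)) /\
  (forall d (P : subspace) f g p i, (forall q, P q -> sph n (f q) /\ sph n (g q)) -> P p ->
     (forall i, (i < n.+1)%N -> cont_at d P (fun q => f q i) p) ->
     (forall i, (i < n.+1)%N -> cont_at d P (fun q => g q i) p) ->
     (i < n.+1)%N -> cont_at d P (fun q => B (f q) (g q) i) p).

Lemma bimap_smap m n B f g : bimap n B -> smap m n f -> smap m n g ->
  smap m n (fun x => B (f x) (g x)).
Proof.
move=> [BS BC] [Sf Cf pf] [Sg Cg pg]; split.
- by move=> x cx; apply: BS; [apply: Sf|apply: Sg].
- move=> i im x cx; apply: BC => //.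
  + by move=> q cq; split; [apply: Sf|apply: Sg].
  + by move=> j jm; apply: Cf.
  + by move=> j jm; apply: Cg.
by move=> x y cx cy xy; rewrite (pf x y) // (pg x y).
Qed.

Lemma smap_fst a n f : smap n n f -> smap (n + a) n f.
Proof.
case=> Sf Cf pf.
have cn x : cube (n + a) x -> cube n x by move=> cx i im; apply: cx; apply: ltn_addr.
split=> [x /cn|i im x cx|x y cx cy xy]; first exact: Sf.
  apply: (@cont_at_comp _ _ n (cube n) id (fun x => f x i)) => // [j jn|]; last exact: Cf (cn _ cx).
  by apply: cont_at_coord; apply: ltn_addr.
by apply: pf; [apply: cn|apply: cn|move=> i im; apply: xy; apply: ltn_addr].
Qed.

Lemma smap_tail a n f : smap n n f -> smap (a + n) n (fun x => f (tail a x)).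
Proof.
case=> Sf Cf pf; split=> [x cx|i im x cx|]; [exact: Sf (cube_tail cx)| |exact: periodic_tail].
apply: (@cont_at_comp _ _ n (cube n) (tail a) (fun x => f x i)).
- by move=> j jn; apply: cont_at_coord; rewrite ltn_add2l.
- exact: cube_tail.
- exact: Cf (cube_tail cx).
Qed.

(** Suspends the degree to dimension [n + n]: a path moves [v] to the pole, the value of the
    collapse at the center, and the product computation identifies the degree of [B (f x) pole] with
    that of the pair formed by [B (f x) (c y)] and [c y]. *)
Lemma count_bimap_zero n B ta tb f v : (0 < n)%N -> bimap n B -> 0 <= ta <= 1 -> 0 <= tb <= 1 ->
  (forall f, smap (n + n) n f -> let g x := collapse n (tail n x) in
     eventually (fun N =>
       count (n + n) N (fun k x => pairK n ta tb (B (f x) (g x)) (g x) k) = false)) ->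
  smap n n f -> sph n v ->
  eventually (fun M => count n M.*2.+1 (fun k x => sphK n ta (B (f x) v) k) = false).
Proof.
move=> n0 bB ta01 tb01 av sf sv.
have [g [Sg Cg g0 g1]] := sph_path n0 sv.
have [Sf Cf pf] := sf; have [BS BC] := bB.
have h1 : shom n n (fun t x => B (f x) (g t)).
  split=> [t x t01 cx|i im x cx|t t01 x y cx cy xy].
  - by apply: BS; [apply: Sf|apply: Sg].
  - have cn y : cube n.+1 y -> cube n y by move=> cy j jm; apply: cy; apply: ltnW.
    apply: BC => //.
    + by move=> q cq; split; [apply: Sf; apply: cn|apply: Sg; apply: cq].
    + by move=> j jm; apply: contr_cube_succ => //; apply: Cf.
    + by move=> j jm; apply: Cg; [|apply: cx|apply: cont_at_coord].
  by rewrite (pf x y).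
have H1 := eventually_odd (count_sph_homotopy n0 h1 ta01 ta01).
rewrite g0 g1 in H1.
pose c x := collapse n (tail n x).
have sc : smap (n + n) n c := smap_tail _ (smap_collapse n).
have sF : smap (n + n) n (fun x => B (f x) (c x)) by apply: bimap_smap => //; apply: smap_fst.
have o01 : 0 <= 0 <= 1 by lra.
(* The second parameter moves from [tb] to 0 because the product computation needs the components of
   [c] to be its bare coordinates. *)
have H2 := eventually_odd (count_pair_homotopy n0 (smap_shom sF) (smap_shom sc) ta01 tb01 ta01 o01).
have H3 := eventually_odd (av f (smap_fst n sf)).
have := @count_collapse_product n n (fun k x => pairK n ta 0 (B (f x) (c x)) (c x) k)
  (fun x => B (f x) (c x) 0%N - 1 / 2).
case.
- move=> x _; rewrite /pairK eqxx /c /Rmin; case: Rle_dec => ?; split; try (move=> ?; split); try (move=> [? ?]); lra.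
- move=> k x kn _; rewrite /pairK eqn_add2l ltn_eqF // ltnNge leq_addr /= addKn /sphK ltn_eqF //.
  by case: eqP => _; rewrite /c; ring.
move=> M0 H4; apply: eventually_mono (eventually_and (eventually_and H1 H2)
  (eventually_and H3 (ex_intro _ M0 H4))) => M [[E1 E2] [E3 E4]].
rewrite -E1 -E3 E2 E4; apply: eq_count => k x kn cx.
have wc : cube (n + n) (with_center n n x).
  by move=> i; rewrite /with_center => ->; case: ifP => [/cx //|_]; lra.
have -> : f x = f (with_center n n x).
  apply: pf => // [i im|i im]; first by apply: wc; apply: ltn_addr.
  by left; rewrite /with_center im.
have -> : c (with_center n n x) = pole.
  apply: collapse_center => i im.
  by rewrite /tail /with_center ltnNge leq_addr /= ltn_add2l im.
case: eqP => [->|/eqP ne]; first by rewrite /sphK eqxx.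
have kn' : (k < n)%N by rewrite ltn_neqAle ne.
by rewrite /pairK ltn_eqF ?kn' // ltn_addr.
Qed.

(** * Pinching the torus along its first coordinate *)

Definition half1 (s : R) := Rmin (2 * s) 1.
(** This is max (0, 2 s - 1), expressed through [Rmin], for which continuity is at hand. *)
Definition half2 (s : R) := 1 - Rmin (2 * (1 - s)) 1.

Lemma half1_01 s : 0 <= s <= 1 -> 0 <= half1 s <= 1.
Proof. rewrite /half1 /Rmin; case: Rle_dec => ? ?; lra. Qed.

Lemma half2_01 s : 0 <= s <= 1 -> 0 <= half2 s <= 1.
Proof. rewrite /half2 /Rmin; case: Rle_dec => ? ?; lra. Qed.

Lemma shom_reparam n f (h : R -> R) : (0 < n)%N -> smap n n f ->
  (forall s, 0 <= s <= 1 -> 0 <= h s <= 1) -> h 0 = 0 -> h 1 = 1 ->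
  (forall d (P : subspace) s p, cont_at d P s p -> cont_at d P (fun q => h (s q)) p) ->
  shom n n (fun t x => f (upd x 0 (lerp (x 0%N) (h (x 0%N)) t))).
Proof.
move=> n0 [Sf Cf pf] h01 h0 h1 Ch.
have cu t x : 0 <= t <= 1 -> cube n x -> cube n (upd x 0 (lerp (x 0%N) (h (x 0%N)) t)).
  move=> t01 cx i im; rewrite /upd; case: eqP => _; last exact: cx.
  by apply: lerp01 => //; [apply: cx|apply: h01; apply: cx].
have cn x : cube n.+1 x -> cube n x by move=> cx j jm; apply: cx; apply: ltnW.
split=> [t x t01 cx|i im x cx|t t01 x y cx cy xy].
- by apply: Sf; apply: cu.
- apply: (@cont_at_comp _ _ n (cube n)
    (fun x => upd x 0 (lerp (x 0%N) (h (x 0%N)) (x n))) (fun x => f x i)).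
  + move=> j jn; rewrite /upd; case: eqP => _; last by apply: cont_at_coord; apply: ltnW.
    have Cx : cont_at n.+1 (cube n.+1) (fun q => q 0%N) x by apply: cont_at_coord.
    have Cn : cont_at n.+1 (cube n.+1) (fun q => q n) x by apply: cont_at_coord.
    apply: cont_at_plus; apply: cont_at_mult => //; last exact: Ch.
    by apply: cont_at_minus => //; apply: cont_at_const.
  + by move=> q cq; apply: cu; [apply: cq|apply: cn].
  + by apply: Cf => //; apply: cu; [apply: cx|apply: cn].
apply: pf; [exact: cu|exact: cu|move=> i im].
rewrite /upd; case: eqP => [_|_]; last exact: xy.
case: (xy 0%N n0) => [->|[-> ->]]; first by left.
by right; rewrite h0 h1 /lerp; split; ring.
Qed.

Lemma shom_smap m n f t : 0 <= t <= 1 -> shom m n f -> smap m n (f t).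
Proof.
move=> t01 [Sf Cf pf]; split=> [x cx|i im x cx|]; [exact: Sf| |exact: pf].
have cu y : cube m y -> cube m.+1 (upd y m t).
  by move=> cy j; rewrite ltnS leq_eqVlt /upd; case: eqP => //= _; apply: cy.
have E y j : cube m y -> f t (upd y m t) j = f t y j.
  move=> cy; have -> // : f t (upd y m t) = f t y.
  by apply: (pf t t01) => // k km; rewrite /upd ltn_eqF //; [apply: cy|left].
apply: (@cont_at_ext _ _ _ (fun y => f (upd y m t m) (upd y m t) i)) => //.
  by move=> y cy; rewrite [upd y m t m]/upd eqxx E.
apply: (@cont_at_comp _ _ m.+1 (cube m.+1) (fun y => upd y m t) (fun y => f (y m) y i)) => //.
  move=> j; rewrite /upd ltnS; case: eqP => [_ _|ne jm]; first exact: cont_at_const.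
  by apply: cont_at_coord; rewrite ltn_neqAle jm andbT; apply/eqP.
by apply: Cf => //; apply: cu.
Qed.

(* Up to homotopy, [f] may be confined to one half of the torus and [g] to the
   other, where the degree is computed separately. *)
Lemma count_pinch n B tau f g u v : (0 < n)%N -> bimap n B -> 0 <= tau <= 1 ->
  smap n n f -> smap n n g -> sph n u -> sph n v ->
  (forall x, cube n x -> x 0%N = 0 \/ x 0%N = 1 -> f x = u /\ g x = v) ->
  (forall f, smap n n f -> eventually (fun M =>
     count n M.*2.+1 (fun k x => sphK n tau (B (f x) v) k) = false)) ->
  (forall g, smap n n g -> eventually (fun M =>
     count n M.*2.+1 (fun k x => sphK n tau (B u (g x)) k) = false)) ->
  eventually (fun M => count n M.*2.+1 (fun k x => sphK n tau (B (f x) (g x)) k) = false).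
Proof.
move=> n0 bB tau01 sf sg su sv base Z1 Z2.
have hf : shom n n (fun t x => f (upd x 0 (lerp (x 0%N) (half1 (x 0%N)) t))).
  apply: shom_reparam => //; first exact: half1_01.
  - by rewrite /half1 /Rmin; case: Rle_dec => ?; lra.
  - by rewrite /half1 /Rmin; case: Rle_dec => ?; lra.
  move=> d P s p Cs; apply: cont_at_min; last exact: cont_at_const.
  exact: cont_at_scal.
have hg : shom n n (fun t x => g (upd x 0 (lerp (x 0%N) (half2 (x 0%N)) t))).
  apply: shom_reparam => //; first exact: half2_01.
  - by rewrite /half2 /Rmin; case: Rle_dec => ?; lra.
  - by rewrite /half2 /Rmin; case: Rle_dec => ?; lra.
  move=> d P s p Cs; apply: cont_at_minus; first exact: cont_at_const.
  apply: cont_at_min; last exact: cont_at_const.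
  by apply: cont_at_scal; apply: cont_at_minus => //; apply: cont_at_const.
have hB : shom n n (fun t x => B (f (upd x 0 (lerp (x 0%N) (half1 (x 0%N)) t)))
    (g (upd x 0 (lerp (x 0%N) (half2 (x 0%N)) t)))).
  have [Sf Cf pf] := hf; have [Sg Cg pg] := hg; have [BS BC] := bB.
  have cn x : cube n.+1 x -> cube n x by move=> cx j jm; apply: cx; apply: ltnW.
  split=> [t x t01 cx|i im x cx|t t01 x y cx cy xy].
  - by apply: BS; [apply: Sf|apply: Sg].
  - apply: (BC _ (cube n.+1) (fun x => f (upd x 0 (lerp (x 0%N) (half1 (x 0%N)) (x n))))
     (fun x => g (upd x 0 (lerp (x 0%N) (half2 (x 0%N)) (x n))))) => //.
    + by move=> q cq; split; [apply: (Sf (q n))|apply: (Sg (q n))] => //; try exact: cn; apply: cq.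
    + by move=> j jm; apply: (Cf j).
    + by move=> j jm; apply: (Cg j).
  by rewrite (pf t t01 x y) // (pg t t01 x y).
have one01 : 0 <= 1 <= 1 by lra.
pose f1 x := f (upd x 0 (half1 (x 0%N))); pose g1 x := g (upd x 0 (half2 (x 0%N))).
have f1E : f1 = fun x => f (upd x 0 (lerp (x 0%N) (half1 (x 0%N)) 1)).
  by apply: functional_extensionality => x; rewrite lerp_1.
have g1E : g1 = fun x => g (upd x 0 (lerp (x 0%N) (half2 (x 0%N)) 1)).
  by apply: functional_extensionality => x; rewrite lerp_1.
have sf1 : smap n n f1 by rewrite f1E; apply: (shom_smap one01 hf).
have sg1 : smap n n g1 by rewrite g1E; apply: (shom_smap one01 hg).
have H := eventually_odd (count_sph_homotopy n0 hB tau01 tau01).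
apply: eventually_mono (eventually_and H (eventually_and (Z1 f1 sf1) (Z2 g1 sg1))) => M.
set N := M.*2.+1 => -[E [E1 E2]].
have upd_id x s : s = x 0%N -> upd x 0 s = x.
  by move=> ->; apply: functional_extensionality => i; rewrite /upd; case: eqP => [->|].
rewrite (@eq_count n N _ (fun k x => sphK n tau (B (f (upd x 0 (lerp (x 0%N) (half1 (x 0%N)) 0)))
  (g (upd x 0 (lerp (x 0%N) (half2 (x 0%N)) 0)))) k)); last first.
  by move=> k x _ _; rewrite !lerp_0 upd_id.
rewrite E (@eq_count n N _ (fun k x => sphK n tau (B (f1 x) (g1 x)) k)); last first.
  by move=> k x _ _; rewrite !lerp_1.
rewrite -[RHS]/(false (+) false) -[X in X (+) _]E1 -[X in _ (+) X]E2 !countE -big_split /=.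
apply: eq_bigr => x _.
pose o : 'I_n := Ordinal n0.
have N1 : 0 < INR N.+1 by apply: lt_0_INR; apply/ltP.
have NE : INR N.+1 = 2 * INR M.+1.
  by rewrite -[2]/(INR 2) -mult_INR; congr INR; rewrite multE mul2n.
have M1 : 0 < INR M.+1 by apply: lt_0_INR; apply/ltP.
have pto (y : torus n N) : pt y 0%N = INR (y o) / INR N.+1.
  rewrite /pt (insubT (fun i => (i < n)%N) n0); congr (INR (y _) / _); exact: val_inj.
have gv (y : torus n N) : (y o <= M.+1)%N -> g1 (pt y) = v.
  move=> /leP /le_INR yM; have := pt_cube y n0; rewrite pto => y01.
  have z : half2 (pt y 0%N) = 0.
    rewrite pto /half2; have : INR (y o) / INR N.+1 <= 1 / 2.
      apply: (Rmult_le_reg_r (INR N.+1)) => //.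
      have -> : INR (y o) / INR N.+1 * INR N.+1 = INR (y o) by field; lra.
      lra.
    by rewrite /Rmin; case: Rle_dec => ?; lra.
  rewrite /g1 z; apply: (proj2 (base _ _ _)); last by left; rewrite /upd.
  by move=> i im; rewrite /upd; case: eqP => _; [lra|apply: pt_cube].
(* Coordinate 0 occurs after a wrap from [N]; there [half1] is 0, and [base] gives the value [u] as
   well. *)
have fu (y : torus n N) : (M.+1 <= y o)%N \/ y o = 0%N :> nat -> f1 (pt y) = u.
  have y01 := pt_cube y n0.
  have H01 : half1 (pt y 0%N) = 0 \/ half1 (pt y 0%N) = 1 -> f1 (pt y) = u.
    move=> h; apply: (proj1 (base _ _ _)); last by rewrite /upd.
    move=> i im; rewrite /upd; case: eqP => _; last exact: pt_cube.
    exact: half1_01.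
  case=> [/leP /le_INR yM|y0]; apply: H01.
    right; rewrite pto /half1; have : 1 / 2 <= INR (y o) / INR N.+1.
      apply: (Rmult_le_reg_r (INR N.+1)) => //.
      have -> : INR (y o) / INR N.+1 * INR N.+1 = INR (y o) by field; lra.
      lra.
    by rewrite /Rmin; case: Rle_dec => ?; lra.
  left; rewrite pto y0 /half1 /Rdiv Rmult_0_l Rmult_0_r /Rmin; case: Rle_dec => ? //; lra.
(* The grid has [2 M + 2] steps, so the midpoint [M + 1] is a grid value and every cell lies in one
   closed half. On the half where one of the two maps is constant, the term with the other map held
   fixed has constant labels and vanishes. *)
have [xM|xM] := leqP (x o) M.
  have cv y : cell x y -> g1 (pt y) = v.
    move=> c; apply: gv; case: (c o) => ->; first exact: leqW.
    have h : ((x o).+1 < N.+1)%N by rewrite ltnS; apply: leq_ltn_trans xM _; rewrite /N ltnS -addnn leq_addr.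
    by rewrite /ordS /= modn_small.
  rewrite (@eq_cell_term _ _ _ (fun k x => sphK n tau (B (f1 x) v) k)); last first.
    by move=> k y _ /cv ->.
  rewrite [X in _ (+) X](@cell_term_const _ _ _ _ 0%N (posb (sphK n tau (B u v) 0%N))) ?addbF //.
  by move=> y /cv ->.
have cu y : cell x y -> f1 (pt y) = u.
  move=> c; apply: fu; case: (c o) => ->; first by left.
  have := ltn_ord (x o); rewrite leq_eqVlt ltnS => /orP[/eqP[xN]|xN].
    by right; rewrite /ordS /= xN modnn.
  by left; rewrite /ordS /= modn_small // ltnW // ltnS ltnW.
rewrite (@eq_cell_term _ _ _ (fun k x => sphK n tau (B u (g1 x)) k)); last first.
  by move=> k y _ /cu ->.
rewrite [X in X (+) _](@cell_term_const _ _ _ _ 0%N (posb (sphK n tau (B u v) 0%N))) ?addFb //.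
by move=> y /cu ->.
Qed.

(** * The wedges *)

Lemma dimE n : dimS2 n = (n.+1 + n.+1)%N.
Proof. by rewrite /dimS2 multE plusE mul2n -addnn !addnS !addSn addn0. Qed.

Lemma dim_fst n i : (i < n.+1)%N -> (i < dimS2 n)%N.
Proof. by move=> h; rewrite dimE ltn_addr. Qed.

Lemma dim_snd n i : (i < n.+1)%N -> (n.+1 + i < dimS2 n)%N.
Proof. by move=> h; rewrite dimE ltn_add2l. Qed.

Definition rho k : R := / INR k.+1.

Lemma rho_gt0 k : 0 < rho k.
Proof. by apply: Rinv_0_lt_compat; apply: lt_0_INR; apply/ltP. Qed.

Lemma rho0 : rho 0 = 1.
Proof. by rewrite /rho /=; field. Qed.

Lemma rho_ratio k : rho k.+1 / rho k <= 1 /\ rho k / rho k.+1 <= 2.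
Proof.
have k0 := pos_INR k.
have -> : rho k.+1 / rho k = 1 - / (INR k + 2) by rewrite /rho !S_INR; field; lra.
have -> : rho k / rho k.+1 = 1 + / (INR k + 1) by rewrite /rho !S_INR; field; lra.
have := Rinv_0_lt_compat (INR k + 2) ltac:(lra).
have : / (INR k + 1) <= / 1 by apply: Rinv_le_contravar; lra.
rewrite Rinv_1; lra.
Qed.

(** The radius closest to [rho k] is [rho k.+1], and the difference of these two is exactly their
    product. *)
Lemma rho_gap k k' : k != k' -> rho k * rho k.+1 <= Rabs (rho k' - rho k).
Proof.
have H a b : (a < b)%N -> rho a - rho b = (INR b - INR a) * (rho a * rho b) /\ 1 <= INR b - INR a.
  move=> ab; have := pos_INR a; have := pos_INR b => a0 b0.
  split; first by rewrite /rho !S_INR; field; lra.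
  by have := le_INR _ _ (elimT leP ab); rewrite S_INR; lra.
have anti a b : (a <= b)%N -> rho b <= rho a.
  move=> ab; apply: Rinv_le_contravar; first by apply: lt_0_INR; apply/ltP.
  by apply: le_INR; apply/leP.
have k0 := rho_gt0 k; have k1 := rho_gt0 k.+1; have k'0 := rho_gt0 k'.
rewrite neq_ltn => /orP[lt|lt].
  have [E _] := H k k' lt; have [E' _] := H k k.+1 (ltnSn k); have := anti _ _ lt.
  rewrite Rabs_minus_sym Rabs_pos_eq; last by have := anti _ _ (ltnW lt); lra.
  by move=> h; apply: Rle_trans (_ : rho k - rho k.+1 <= _); [rewrite E' S_INR; nra|lra].
have [E h] := H k' k lt; rewrite Rabs_pos_eq; last by have := anti _ _ (ltnW lt); lra.
have a1 := anti k' k.+1 (leq_trans (ltnW lt) (leqnSn k)).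
have a2 : rho k * rho k.+1 <= rho k' * rho k by nra.
have a3 : 0 < rho k' * rho k by apply: Rmult_lt_0_compat.
by rewrite E; nra.
Qed.

(* Piece 0 is the sphere added in [S1], piece [k + 1] is the product of spheres
   of radius [1 / (k + 2)] in [S0]; all pieces then have radius [rho k]. *)
Definition piece n (k : nat) (p : Rd) :=
  [/\ supported (dimS2 n) p, onSphere n (rho k) 0 p, onSphere n (rho k) n.+1 p
    & k = 0%N -> supported (S n) p].

Lemma S0_piece n p : S0 n p <-> exists k, piece n k.+1 p.
Proof.
have E k : / INR (k + 2)%coq_nat = rho k.+1 by rewrite /rho plusE addn2.
split=> [[s [k]]|[k [s h1 h2 _]]]; first by rewrite E => -[h1 h2]; exists k.
by split=> //; exists k; rewrite E.
Qed.

Lemma S1_piece n p : S1 n p <-> exists k, piece n k p.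
Proof.
split=> [[[s h]|/S0_piece[k pk]]|[[|k] pk]]; [exists 0%N|by exists k.+1|left|right].
- split=> //; last 1 first.
  + apply/onSphereE; rewrite s; last by apply/leP.
    have -> : sumsq n.+1 (fun i => p (n.+1 + i)%N) = sumsq n.+1 (fun=> 0).
      by apply: eq_sumsq => i _; apply: s; apply/leP; rewrite leq_addr.
    by rewrite sumsq_one //; ring.
  + move=> i /leP hi; apply: s; apply/leP; apply: leq_trans hi; rewrite dimE; exact: leq_addr.
  + by rewrite rho0.
- by case: pk => _; rewrite rho0 => h1 _ /(_ erefl) h2; split.
by apply/S0_piece; exists k.
Qed.

Lemma S0_S1 n p : S0 n p -> S1 n p.
Proof. by right. Qed.

Lemma piece_nonneg n k p o : onSphere n (rho k) o p -> 0 <= p o.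
Proof.
move=> /onSphereE E; have := sumsq_ge0 n.+1 (fun i => p (o + i)%N); rewrite E.
have := rho_gt0 k; nra.
Qed.

Lemma piece_origin n k p : piece n k p -> p 0%N = 0 -> p n.+1 = 0 -> p = fun=> 0.
Proof.
move=> [s /onSphereE E1 /onSphereE E2 _] p0 p1; apply: functional_extensionality => i.
have [h|h] := ltnP i n.+1.
  by rewrite p0 Rmult_0_r in E1; have := sumsq_eq0 E1 h.
have [h'|h'] := ltnP i (dimS2 n); last by apply: s; apply/leP.
rewrite p1 Rmult_0_r in E2; have := sumsq_eq0 E2 (i := (i - n.+1)%N).
by rewrite subnKC //; apply; rewrite ltn_subLR // -dimE.
Qed.

(** In a block where [p o] is positive, the defining equation of piece [k], evaluated at a point [q]
    of piece [k'], has defect 2 (rho k' - rho k) (q o). By [rho_gap] this stays away from 0 near [p]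
    unless [k' = k]. *)
Lemma piece_isolated n k p : piece n k p -> p <> (fun=> 0) -> exists delta, 0 < delta /\
  forall q k', piece n k' q -> dist (dimS2 n) q p < delta -> k' = k.
Proof.
move=> pk ne; have [_ h1 h2 _] := pk.
have [o [od po oE]] : exists o, [/\ o = 0%N \/ o = n.+1, 0 < p o &
    sumsq n.+1 (fun i => p (o + i)%N) = 2 * rho k * p o].
  have p0 := piece_nonneg h1; have p1 := piece_nonneg h2.
  have [z0|n0] := Req_dec (p 0%N) 0; last by exists 0%N; split; [left|lra|apply/onSphereE].
  have [z1|n1] := Req_dec (p n.+1) 0; last by exists n.+1; split; [right|lra|apply/onSphereE].
  by case: ne; apply: piece_origin pk z0 z1.
have oi i : (i < n.+1)%N -> (o + i < dimS2 n)%N.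
  by case: od => -> im; [apply: dim_fst|apply: dim_snd].
have od' : (o < dimS2 n)%N by rewrite -[o]addn0; apply: oi.
have C : cont_at (dimS2 n) (fun=> True) (fun q => sumsq n.+1 (fun i => q (o + i)%N) - 2 * rho k * q o) p.
  apply: cont_at_minus; last by apply: cont_at_scal; apply: cont_at_coord.
  by apply: (cont_at_sumsq (f := fun q i => q (o + i)%N)) => i im; apply: cont_at_coord; apply: oi.
have r0 := rho_gt0 k; have r1 := rho_gt0 k.+1.
have g0 : 0 < rho k * rho k.+1 by apply: Rmult_lt_0_compat.
have [e [e0 He]] := C (rho k * rho k.+1 * p o) (Rmult_lt_0_compat _ _ g0 po).
exists (Rmin e (p o / 2)); split; first by apply: Rmin_pos; lra.
move=> q k' qk dq; have m1 := Rmin_l e (p o / 2); have m2 := Rmin_r e (p o / 2).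
have := He q I ltac:(lra); rewrite oE Rminus_diag Rminus_0_r.
have qE : sumsq n.+1 (fun i => q (o + i)%N) = 2 * rho k' * q o.
  by case: qk => _ /onSphereE q1 /onSphereE q2 _; case: od => ->.
have : Rabs (q o - p o) < p o / 2 by have := coord_le_dist q p od'; lra.
rewrite qE => /Rabs_def2 h; have -> : 2 * rho k' * q o - 2 * rho k * q o = (rho k' - rho k) * (2 * q o) by ring.
rewrite Rabs_mult (Rabs_pos_eq (2 * q o)); last lra.
move=> h'; apply/eqP; rewrite eq_sym; apply/negPn/negP => /rho_gap gap.
apply: (Rlt_not_le _ _ h'); apply: Rmult_le_compat; lra.
Qed.

Lemma piece_uniq n k k' p : piece n k p -> piece n k' p -> p <> (fun=> 0) -> k' = k.
Proof.
move=> pk pk' ne; have [d [d0 Hd]] := piece_isolated pk ne.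
by apply: (Hd p) => //; rewrite dist_eq0.
Qed.

(** The piece is unique except at the base point. There the arbitrary choice does no harm, since
    [wedge_map] is linear on each piece and sends 0 to 0. *)
Definition index n (p : Rd) : nat := epsilon (inhabits 0%N) (fun k => piece n k p).

(* The map that is the coordinatewise linear map [p |-> (a k i * p (s k i))_i]
   on piece [k] of the wedge. *)
Definition wedge_map n (a : nat -> nat -> R) (s : nat -> nat -> nat) (p : Rd) : Rd :=
  fun i => a (index n p) i * p (s (index n p) i).

Lemma wedge_mapE n a s k p : piece n k p -> wedge_map n a s p = fun i => a k i * p (s k i).
Proof.
move=> pk; apply: functional_extensionality => i; rewrite /wedge_map.
have [->|ne] := classic (p = fun=> 0); first by rewrite !Rmult_0_r.
have pk' : piece n (index n p) p.
  by apply: (epsilon_spec (inhabits 0%N) (fun k => piece n k p)); exists k.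
by rewrite (piece_uniq pk pk' ne).
Qed.

(** Away from the base point the map is locally one linear map by [piece_isolated]; at the base
    point the bound [C], uniform over the pieces, gives continuity. *)
Lemma contr_wedge_map n a s i C (P : subspace) : (forall p, P p -> S1 n p) ->
  (forall k, Rabs (a k i) <= C) -> (forall k, a k i = 0 \/ (s k i < dimS2 n)%N) ->
  contr (dimS2 n) P (fun p => wedge_map n a s p i).
Proof.
move=> PS aC sd p Pp; have [k pk] := proj1 (S1_piece n p) (PS p Pp).
have [p0|ne] := classic (p = fun=> 0).
  move=> eps e0; have C0 : 0 <= C by have := aC 0%N; have := Rabs_pos (a 0%N i); lra.
  exists (eps / (C + 1)); split; first by apply: Rdiv_lt_0_compat; lra.
  move=> q Pq dq; have [l ql] := proj1 (S1_piece n q) (PS q Pq).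
  rewrite (wedge_mapE _ _ pk) (wedge_mapE _ _ ql) p0 Rmult_0_r Rminus_0_r.
  case: (sd l) => [->|sl]; first by rewrite Rmult_0_l Rabs_R0.
  have := coord_le_dist q p sl; rewrite p0 Rminus_0_r Rabs_mult => h.
  have dE : (C + 1) * (eps / (C + 1)) = eps by field; lra.
  rewrite p0 in dq; have := aC l; have := Rabs_pos (a l i); have := Rabs_pos (q (s l i)); nra.
have [e [e0 He]] := piece_isolated pk ne.
apply: (cont_at_local (k' := fun q => a k i * q (s k i)) e0).
- move=> q Pq dq; have [l ql] := proj1 (S1_piece n q) (PS q Pq).
  by have E := He q l ql dq; rewrite (wedge_mapE _ _ ql) E.
- by rewrite (wedge_mapE _ _ pk).
case: (sd k) => [z|sk]; last by apply: cont_at_scal; apply: cont_at_coord.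
rewrite z; apply: (cont_at_ext (k' := fun=> 0)) => // [q _|]; first by rewrite Rmult_0_l.
exact: cont_at_const.
Qed.

Lemma piece_scal n k k' p : piece n k p -> (k' = 0%N -> k = 0%N) ->
  piece n k' (fun i => rho k' / rho k * p i).
Proof.
move=> [s /onSphereE h1 /onSphereE h2 h3] k'k; have r0 := rho_gt0 k; split.
- by move=> i /s ->; ring.
- by apply/onSphereE; rewrite sumsq_scal h1; field; lra.
- by apply/onSphereE; rewrite sumsq_scal h2; field; lra.
by move=> /k'k /h3 h i /h ->; ring.
Qed.

Lemma piece_zero n k : piece n k (fun=> 0).
Proof. by split=> //; apply/onSphereE; rewrite sumsq_one //; ring. Qed.

Definition idm (_ : nat) (i : nat) := i.

Definition retract n (j : nat) := wedge_map n (fun k _ => if k == j then 1 else 0) idm.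

Lemma retract_on n j p : piece n j p -> retract n j p = p.
Proof.
move=> pj; rewrite /retract (wedge_mapE _ _ pj) eqxx.
by apply: functional_extensionality => i; rewrite Rmult_1_l.
Qed.

Lemma retract_off n j k p : piece n k p -> k != j -> retract n j p = fun=> 0.
Proof.
move=> pk /negbTE kj; rewrite /retract (wedge_mapE _ _ pk) kj.
by apply: functional_extensionality => i; rewrite Rmult_0_l.
Qed.

Lemma retract_piece n j p : S1 n p -> piece n j (retract n j p).
Proof.
move=> /S1_piece[k pk]; have [E|kj] := eqVneq k j; first by rewrite -E retract_on.
by rewrite (retract_off pk kj); apply: piece_zero.
Qed.

Lemma retract_dist n j p : S1 n p ->
  dist (dimS2 n) (retract n j p) (fun=> 0) <= dist (dimS2 n) p (fun=> 0).
Proof.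
move=> /S1_piece[k pk]; have [E|kj] := eqVneq k j; first by rewrite -E retract_on //; lra.
by rewrite (retract_off pk kj) (dist_eq0 (p := fun=> 0)) //; apply: dist_ge0.
Qed.

(* Near the base point of the wedge no cell contributes to the degree, and away
   from it the whole cell lies in a single piece. *)
Lemma count_wedge n tau h g : (0 < n)%N -> 0 <= tau <= 1 ->
  (forall p, S0 n p -> sph n (h p)) ->
  (forall i, (i < n.+1)%N -> contr (dimS2 n) (S0 n) (fun p => h p i)) ->
  ~ ((forall k, (k < n)%N -> sphK n tau (h (fun=> 0)) k = 0) /\ 0 < h (fun=> 0) 0%N) ->
  (forall x, cube n x -> S0 n (g x)) ->
  (forall i, (i < dimS2 n)%N -> contr n (cube n) (fun x => g x i)) -> periodic n g ->
  (forall j, eventually (fun M =>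
     count n M.*2.+1 (fun k x => sphK n tau (h (retract n j.+1 (g x))) k) = false)) ->
  eventually (fun M => count n M.*2.+1 (fun k x => sphK n tau (h (g x)) k) = false).
Proof.
move=> n0 t01 Sh Ch nc Sg Cg pg Z; set d := dimS2 n; set o : Rd := fun=> 0.
have So : S0 n o by apply/S0_piece; exists 0%N; apply: piece_zero.
(* Since the base point does not go to the test point, some component [k0] has a constant sign near
   it: either one of the first [n] is nonzero there, or they all vanish and the last one is
   negative. *)
have [r [r0 [k0 [b [k0n kb Hr]]]]] : exists r, 0 < r /\ exists k0 b, [/\ (k0 <= n)%N,
    k0 = n -> b = false & forall q, S0 n q -> dist d q o < r -> posb (sphK n tau (h q) k0) = b].
  have [k0 [k0n nz neg]] : exists k0, [/\ (k0 <= n)%N, sphK n tau (h o) k0 <> 0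
      & k0 = n -> sphK n tau (h o) k0 < 0].
    have [[k [kn kz]]|N] := classic (exists k, (k < n)%N /\ sphK n tau (h o) k <> 0).
      by exists k; split=> //; [apply: ltnW|move=> kE; move: kn; rewrite kE ltnn].
    have Zk k : (k < n)%N -> sphK n tau (h o) k = 0.
      by move=> kn; apply: NNPP => ne; apply: N; exists k.
    have h0 : h o 0%N <= 0 by apply: Rnot_lt_le => h0; apply: nc.
    by exists n; rewrite /sphK eqxx; split=> //; lra.
  have Ck : cont_at d (S0 n) (fun q => sphK n tau (h q) k0) o.
    apply: cont_at_sphK => // [|i im]; first exact: cont_at_const.
    by apply: Ch.
  have [r [r0 Hr]] := Ck _ (Rabs_pos_lt _ nz).
  exists r; split=> //; exists k0, (posb (sphK n tau (h o) k0)); split=> //.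
    by move=> /neg lt; apply/negbTE/posbP; lra.
  move=> q Sq /(Hr q Sq); set a := sphK n tau (h q) k0; set c := sphK n tau (h o) k0.
  by rewrite /posb /Rabs; do 2 case: Rcase_abs => ?; do 2 case: Rlt_dec => ? //; lra.
(* Compactness is applied to an alternative: near [x] either [g] stays close to the base point or it
   stays in one piece. Requiring [INR k <= / e] in the second case makes the resulting uniform scale
   bound the number of pieces involved. *)
have [x e1 e2 [H|[k [ke Hk]]] e12|x cx|e [e0 He]] := @cube_compact n (fun x e =>
    (forall y, cube n y -> (forall i, (i < n)%N -> Rabs (y i - x i) < e) -> dist d (g y) o < r) \/
    (exists k, INR k <= / e /\ forall y, cube n y ->
       (forall i, (i < n)%N -> Rabs (y i - x i) < e) -> piece n k.+1 (g y))).
- by left=> y cy yx; apply: H => // i im; have := yx i im; lra.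
- right; exists k; split.
    by apply: Rle_trans ke _; apply: Rinv_le_contravar; lra.
  by move=> y cy yx; apply: Hk => // i im; have := yx i im; lra.
- have [g0|gn0] := classic (g x = o).
    have [a [a0 Ha]] := cont_at_dist (fun i id => Cg i id x cx) r0.
    have [e [e0 He]] := @sup_near_dist n a a0.
    exists (e / 2); split; first lra.
    move=> y cy yx; left=> z cz zy; rewrite -g0; apply: Ha => //; apply: He => i im.
    have := Rabs_triang (z i - y i) (y i - x i).
    have -> : z i - y i + (y i - x i) = z i - x i by ring.
    have := yx i im; have := zy i im; lra.
  have [k pk] := proj1 (S0_piece n (g x)) (Sg x cx).
  have [c [c0 Hc]] := piece_isolated pk gn0.
  have [a [a0 Ha]] := cont_at_dist (fun i id => Cg i id x cx) c0.
  have [e [e0 He]] := @sup_near_dist n a a0.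
  have k1 := pos_INR k.
  have m1 := Rmin_l (e / 2) (/ (INR k + 1)); have m2 := Rmin_r (e / 2) (/ (INR k + 1)).
  have m0 : 0 < Rmin (e / 2) (/ (INR k + 1)).
    by apply: Rmin_pos; [lra|apply: Rinv_0_lt_compat; lra].
  exists (Rmin (e / 2) (/ (INR k + 1))); split=> // y cy yx; right; exists k; split.
    by have := Rinv_le_contravar _ _ m0 m2; rewrite Rinv_inv; lra.
  move=> z cz zy; have [l zl] := proj1 (S0_piece n (g z)) (Sg z cz).
  have -> // : k.+1 = l.+1; apply/esym/(Hc _ _ zl); apply: Ha => //; apply: He => i im.
  have := Rabs_triang (z i - y i) (y i - x i).
  have -> : z i - y i + (y i - x i) = z i - x i by ring.
  have := yx i im; have := zy i im; lra.
have [J HJ] := INR_unbounded (/ e).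
have [N0 HN] := eventually_odd (inv_succ_small e0).
have [N1 HZ] := @eventually_all J.+1 _ (fun j _ => Z j).
exists (maxn N0 N1) => M; rewrite geq_max => /andP[/HN lN /HZ {}Z].
set N := M.*2.+1 in lN Z *.
have -> : count n N (fun k x => sphK n tau (h (g x)) k) = \xor_(j : 'I_J.+1)
    count n N (fun k x => sphK n tau (h (retract n j.+1 (g x))) k); last first.
  by apply: big1 => j _; apply: Z.
under [RHS]eq_bigr => j _ do rewrite countE.
rewrite countE exchange_big /=; apply: eq_bigr => x _.
have lift y : cell x y -> g (pt y) = g (lift_pt x y) by move=> c; rewrite (periodic_lift pg c).
have near y i : (i < n)%N -> Rabs (lift_pt x y i - pt x i) < e.
  by move=> im; apply: Rle_lt_trans lN; apply: lift_pt_near.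
have [H|[k [ke Hk]]] := He (pt x) (pt_cube x).
  have dg y : cell x y -> dist d (g (pt y)) o < r.
    by move=> c; rewrite lift //; apply: H; [apply: lift_pt_cube|apply: near].
  have van h' : (forall y, cell x y -> posb (sphK n tau (h' (pt y)) k0) = b) ->
      cell_term (fun k x => sphK n tau (h' x) k) x = false.
    move=> Hb; move: k0n; rewrite leq_eqVlt => /orP[/eqP E|lt].
      have := Hb x (fun j => or_introl erefl); rewrite E (kb E) => En.
      by rewrite /cell_term En.
    by apply: (cell_term_const lt (a := b)).
  rewrite (van (fun x => h (g x))); last first.
    by move=> y c; apply: Hr; [apply: Sg; apply: pt_cube|apply: dg].
  rewrite big1 // => j _; apply: (van (fun x => h (retract n j.+1 (g x)))) => y c.
  have Sy := Sg _ (pt_cube y); apply: Hr.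
    by apply/S0_piece; exists j; apply: retract_piece; apply: S0_S1.
  by apply: Rle_lt_trans (dg y c); apply: retract_dist; apply: S0_S1.
have pk y : cell x y -> piece n k.+1 (g (pt y)).
  by move=> c; rewrite lift //; apply: Hk; [apply: lift_pt_cube|apply: near].
have kJ : (k < J.+1)%N.
  rewrite ltnS leqNgt; apply/negP => /ltP /lt_INR; lra.
rewrite (bigD1 (Ordinal kJ)) //= big1 ?addbF.
  by apply: eq_cell_term => l y _ c; rewrite retract_on //; apply: pk.
(* For every other piece the retraction sends the whole cell to the base point, so the labels are
   constant. *)
move=> j jk; apply: (cell_term_const n0 (a := posb (sphK n tau (h o) 0%N))) => y c.
rewrite (retract_off (pk y c)) // eqSS; apply: contraNneq jk => kj.
by apply/eqP; apply: val_inj.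
Qed.

(** * Domination and non-equivalence *)

Lemma is_map_id d (X Y : subspace) : (forall p, X p -> Y p) -> is_map d X Y (fun p => p).
Proof.
move=> XY; split=> //; apply: coord_continuous_on => i id p _; exact: cont_at_coord.
Qed.

Lemma homotopic_eq d (X : subspace) f g : is_map d X X g -> (forall p, X p -> f p = g p) ->
  homotopic d X X f g.
Proof.
move=> [gX gC] E; exists (fun p _ => g p); split; first by move=> p t /gX.
split; last by move=> p Xp i; rewrite E.
move=> p t Xp _ eps e0; have [e [e1 He]] := gC p Xp eps e0.
by exists e; split=> // q s Xq _ dq _; apply: He.
Qed.

Lemma is_map_wedge_scal n a (X Y : subspace) : (forall p, X p -> S1 n p) ->
  (forall k i, 0 <= a k i <= 2) ->
  (forall p, X p -> Y (wedge_map n a idm p)) -> is_map (dimS2 n) X Y (wedge_map n a idm).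
Proof.
move=> XS a2 XY; split=> //; apply: coord_continuous_on => i id.
apply: (@contr_wedge_map _ _ _ _ 2) => // k; last by right.
by rewrite Rabs_pos_eq; have := a2 k i; lra.
Qed.

Lemma dominated_S0_S1 n : dominated (dimS2 n) (S0 n) (S1 n).
Proof.
pose a (k _ : nat) := if k == 0%N then 0 else 1.
have E k p : piece n k.+1 p -> wedge_map n a idm p = p.
  move=> pk; rewrite (wedge_mapE _ _ pk); apply: functional_extensionality => i.
  by rewrite /a /= Rmult_1_l.
exists (fun p => p), (wedge_map n a idm); split; first by apply: is_map_id; apply: S0_S1.
split.
  apply: is_map_wedge_scal => // [k i|p /S1_piece[[|k] pk]]; first by rewrite /a; case: eqP; lra.
    rewrite (wedge_mapE _ _ pk) /a /=; apply/S0_piece; exists 0%N.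
    rewrite (_ : (fun _ => _) = fun=> 0); first exact: piece_zero.
    by apply: functional_extensionality => i; rewrite Rmult_0_l.
  by rewrite (E _ _ pk); apply/S0_piece; exists k.
apply: homotopic_eq; first exact: is_map_id.
by move=> p /S0_piece[k pk]; rewrite (E _ _ pk).
Qed.

(** Piece [k] of [S1] is rescaled onto piece [k + 1], so that the extra sphere becomes S^n x {pt} in
    the first product. The way back projects that product onto its first factor, which is why [b]
    vanishes beyond [n] when [k] is 1. The ratios of successive radii are bounded by 2, which gives
    continuity at the base point. *)
Lemma dominated_S1_S0 n : dominated (dimS2 n) (S1 n) (S0 n).
Proof.
pose a (k _ : nat) := rho k.+1 / rho k.
pose b (k i : nat) := if (k == 1%N) && (n < i)%N then 0 else rho k.-1 / rho k.
have a_pos k i : 0 <= a k i <= 2.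
  by have := Rdiv_lt_0_compat _ _ (rho_gt0 k.+1) (rho_gt0 k); have := rho_ratio k; rewrite /a; lra.
have b_pos k i : 0 <= b k i <= 2.
  rewrite /b; case: ifP => _; first lra.
  case: k => [|k] /=; first by rewrite rho0; lra.
  by have := Rdiv_lt_0_compat _ _ (rho_gt0 k) (rho_gt0 k.+1); have := rho_ratio k; lra.
have aP k p : piece n k p -> piece n k.+1 (wedge_map n a idm p).
  by move=> pk; rewrite (wedge_mapE _ _ pk); apply: piece_scal.
have bP k p : piece n k.+1 p -> piece n k (wedge_map n b idm p).
  move=> pk; rewrite (wedge_mapE _ _ pk) /b /idm; case: k pk => [|k] pk /=; last exact: piece_scal.
  have [s /onSphereE h1 _ _] := pk; have r0 := rho_gt0 1.
  have sup : supported (S n) (fun i => (if (n < i)%N then 0 else rho 0 / rho 1) * p i).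
    by move=> i /leP ni; rewrite ni Rmult_0_l.
  split=> //.
  - by move=> i /s ->; ring.
  - apply/onSphereE; rewrite (@eq_sumsq _ _ (fun i => rho 0 / rho 1 * p i)); last first.
      by move=> i; rewrite ltnS leqNgt => /negbTE ->.
    by rewrite sumsq_scal h1 ltn0; field; lra.
  apply/onSphereE; rewrite ltnSn Rmult_0_l (@eq_sumsq _ _ (fun=> 0)).
    by rewrite sumsq_one //; ring.
  by move=> i _; rewrite addSn ltnS leq_addr Rmult_0_l.
exists (wedge_map n a idm), (wedge_map n b idm); split.
  apply: is_map_wedge_scal => // p /S1_piece[k pk]; apply/S0_piece; exists k; exact: aP.
split.
  apply: is_map_wedge_scal => // [p|p /S0_piece[k pk]]; first exact: S0_S1.
  by apply/S1_piece; exists k; apply: bP.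
apply: homotopic_eq; first exact: is_map_id.
move=> p /S1_piece[k pk]; rewrite (wedge_mapE _ _ (aP _ _ pk)) (wedge_mapE _ _ pk).
apply: functional_extensionality => i; rewrite /a /b /idm /= eqSS.
have r0 := rho_gt0 k; have r1 := rho_gt0 k.+1.
case: ifP => [/andP[/eqP k0 ni]|_]; last by field; lra.
by case: pk => _ _ _ /(_ k0) s; rewrite (s i) ?Rmult_0_r //; apply/leP.
Qed.

Lemma h_equal_S0_S1 n : h_equal (dimS2 n) (S0 n) (S1 n).
Proof. by split; [apply: dominated_S0_S1|apply: dominated_S1_S0]. Qed.

Lemma piece0_sph n p : piece n 0 p -> sph n p.
Proof. by case=> _; rewrite rho0 => h _ /(_ erefl) s; split. Qed.

Lemma sph_piece0 n p : sph n p -> piece n 0 p.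
Proof.
move=> sp; have /S1_piece[k pk] : S1 n p by left.
case: k pk => // k pk; have [->|ne] := classic (p = fun=> 0); first exact: piece_zero.
have [s E] := proj1 (sphE n p) sp; have [_ /onSphereE h1 _ _] := pk.
case: ne; apply: (sph0 sp); move: h1; rewrite (@eq_sumsq _ _ p) // E.
have : rho k.+1 < 1.
  rewrite -Rinv_1; apply: Rinv_lt_contravar; rewrite ?Rmult_1_l !S_INR; have := pos_INR k; lra.
by move=> r1 h; nra.
Qed.

Lemma retract0_sph n p : S1 n p -> sph n (retract n 0 p).
Proof. by move=> /(retract_piece 0); apply: piece0_sph. Qed.

(** Outside the base point the retraction onto the sphere loses nothing. Hence [f p] is determined
    by [h p] whenever [h p] is near a test point, and the image of the retraction paired with [w g]
    is a graph there. *)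
Lemma retract0_eq n p : S1 n p -> 0 < retract n 0 p 0%N -> retract n 0 p = p.
Proof.
move=> /S1_piece[[|k] pk]; first by rewrite retract_on.
by rewrite (retract_off pk) //; lra.
Qed.

Lemma contr_retract n j i (P : subspace) : (forall p, P p -> S1 n p) -> (i < dimS2 n)%N ->
  contr (dimS2 n) P (fun p => retract n j p i).
Proof.
move=> PS id; apply: (@contr_wedge_map _ _ _ _ 1) => // k; last by right.
by case: eqP => _; rewrite ?Rabs_R0 ?Rabs_R1; lra.
Qed.

(** Projection of piece [j] onto one of its two sphere factors, rescaled to radius 1, with the other
    pieces sent to the base point. The offset [o] of the block is 0 or [n.+1]. *)
Definition factor n (j o : nat) := wedge_map n
  (fun k i => if (k == j) && (i <= n)%N then / rho j else 0) (fun _ i => (o + i)%N).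

Lemma factor_sph n j o p : o = 0%N \/ o = n.+1 -> S1 n p -> sph n (factor n j o p).
Proof.
move=> od /S1_piece[k pk]; rewrite /factor (wedge_mapE _ _ pk).
have [E|kj] := eqVneq k j; last first.
  rewrite (_ : (fun _ => _) = fun=> 0); first exact: sph_zero.
  by apply: functional_extensionality => i; rewrite Rmult_0_l.
have r0 := rho_gt0 j; apply/sphE; split=> [i|]; first by rewrite ltnNge => /negbTE ->; rewrite Rmult_0_l.
rewrite (@eq_sumsq _ _ (fun i => / rho j * p (o + i)%N)); last first.
  by move=> i; rewrite ltnS => ->.
have pE : sumsq n.+1 (fun i => p (o + i)%N) = 2 * rho j * p o.
  by case: pk => _ /onSphereE h1 /onSphereE h2 _; rewrite -E; case: od => ->.
by rewrite sumsq_scal pE /= addn0; field; lra.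
Qed.

Lemma contr_factor n j o i (P : subspace) : o = 0%N \/ o = n.+1 -> (forall p, P p -> S1 n p) ->
  contr (dimS2 n) P (fun p => factor n j o p i).
Proof.
move=> od PS; have r0 := Rinv_0_lt_compat _ (rho_gt0 j).
apply: (@contr_wedge_map _ _ _ _ (/ rho j)) => // k.
  by case: ifP => _; rewrite ?Rabs_R0 ?Rabs_pos_eq; lra.
case: ifP => [/andP[_ im]|_]; [right|by left].
by case: od => ->; [apply: dim_fst|apply: dim_snd].
Qed.

Definition pair n (j : nat) (u v : Rd) : Rd := fun i =>
  if (i < n.+1)%N then rho j * u i
  else if (i < dimS2 n)%N then rho j * v (i - n.+1)%N else 0.

Lemma pair_piece n j u v : sph n u -> sph n v -> piece n j.+1 (pair n j.+1 u v).
Proof.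
move=> /sphE[_ su] /sphE[_ sv]; split=> //.
- move=> i /leP h; rewrite /pair !ltnNge h /= [(i <= n)%N]leqNgt.
  by rewrite (leq_trans _ h) // dimE leq_addr.
- apply/onSphereE; rewrite (@eq_sumsq _ _ (fun i => rho j.+1 * u i)); last by rewrite /pair => i ->.
  by rewrite sumsq_scal su /pair /=; ring.
apply/onSphereE; rewrite (@eq_sumsq _ _ (fun i => rho j.+1 * v i)); last first.
  by move=> i im; rewrite /pair ltnNge leq_addr /= dim_snd // addKn.
by rewrite sumsq_scal sv /pair ltnn dimE -[X in (X < _)%N]addn0 ltn_add2l /= subnn; ring.
Qed.

Lemma pair_S0 n j u v : sph n u -> sph n v -> S0 n (pair n j.+1 u v).
Proof. by move=> su sv; apply/S0_piece; exists j; apply: pair_piece. Qed.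

Lemma factor_pair n j u v : sph n u -> sph n v ->
  factor n j.+1 0 (pair n j.+1 u v) = u /\ factor n j.+1 n.+1 (pair n j.+1 u v) = v.
Proof.
move=> su sv; have pk := pair_piece j su sv; have r0 := rho_gt0 j.+1.
have [zu _] := proj1 (sphE n u) su; have [zv _] := proj1 (sphE n v) sv.
rewrite /factor !(wedge_mapE _ _ pk) eqxx /=.
split; apply: functional_extensionality => i; case: leqP => h.
- by rewrite /pair add0n ltnS h /=; field; lra.
- by rewrite zu //; ring.
- by rewrite /pair ltnNge leq_addr /= dim_snd // addKn /=; field; lra.
by rewrite zv //; ring.
Qed.

Lemma retract_pair n j p : S0 n p ->
  retract n j.+1 p = pair n j.+1 (factor n j.+1 0 p) (factor n j.+1 n.+1 p).
Proof.
move=> /S0_piece[k pk]; have r0 := rho_gt0 j.+1.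
rewrite /retract /factor !(wedge_mapE _ _ pk); apply: functional_extensionality => i.
rewrite /pair /idm eqSS; have [E|ne] := eqVneq k j; last first.
  by case: ifP => _; [|case: ifP => _]; rewrite /=; ring.
case: ltnP => h; first by rewrite /= -ltnS h add0n /=; field; lra.
case: ltnP => h'; last by case: pk => s _ _ _; rewrite (s i (elimT leP h')) Rmult_0_r.
have -> : (i - n.+1 <= n)%N by rewrite -ltnS ltn_subLR // -dimE.
by rewrite /= subnKC //; field; lra.
Qed.

Lemma cont_at_pair d (P : subspace) n j (f g : Rd -> Rd) p i :
  (forall i, (i < n.+1)%N -> cont_at d P (fun q => f q i) p) ->
  (forall i, (i < n.+1)%N -> cont_at d P (fun q => g q i) p) ->
  cont_at d P (fun q => pair n j (f q) (g q) i) p.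
Proof.
move=> Cf Cg; rewrite /pair; case: ltnP => h; first by apply: cont_at_scal; apply: Cf.
case: ltnP => h'; last exact: cont_at_const.
by apply: cont_at_scal; apply: Cg; rewrite ltn_subLR // -dimE.
Qed.

(** At a test point [u 1 = tau * u 0] with [u 0] positive, so [u] determines [tau]; it cannot be the
    test point both for 0 and for 1. *)
Lemma center_avoid n u : (0 < n)%N -> sph n u -> exists tau, 0 <= tau <= 1 /\
  ~ ((forall k, (k < n)%N -> sphK n tau u k = 0) /\ 0 < u 0%N).
Proof.
move=> n0 su; apply: NNPP => N.
have H tau : 0 <= tau <= 1 -> (forall k, (k < n)%N -> sphK n tau u k = 0) /\ 0 < u 0%N.
  by move=> t01; apply: NNPP => h; apply: N; exists tau.
have [Z0 u0] := H 0 ltac:(lra); have [Z1 _] := H 1 ltac:(lra).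
by have := Z0 0%N n0; have := Z1 0%N n0; rewrite /sphK ltn_eqF //=; lra.
Qed.

Lemma shom_homotopy m n d (X Y : subspace) (H : Rd -> R -> Rd) (W P : Rd -> Rd) :
  (forall p t, X p -> 0 <= t <= 1 -> Y (H p t)) ->
  (forall p t, X p -> 0 <= t <= 1 -> forall eps, 0 < eps ->
       exists delta, 0 < delta /\
       forall q s, X q -> 0 <= s <= 1 -> dist d q p < delta -> Rabs (s - t) < delta ->
         dist d (H q s) (H p t) < eps) ->
  (forall p, Y p -> sph n (W p)) ->
  (forall i, (i < n.+1)%N -> contr d Y (fun p => W p i)) ->
  (forall x, cube m x -> X (P x)) ->
  (forall i, (i < d)%N -> contr m (cube m) (fun x => P x i)) -> periodic m P ->
  shom m n (fun t x => W (H (P x) t)).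
Proof.
move=> HY HC WS WC PX PC pP; split=> [t x t01 cx|i im x cx|t t01 x y cx cy xy].
- by apply: WS; apply: HY => //; apply: PX.
- have cm y : cube m.+1 y -> cube m y by move=> cy j jm; apply: cy; apply: ltnW.
  have cmm y : cube m.+1 y -> 0 <= y m <= 1 by apply.
  apply: (@cont_at_comp _ _ d Y (fun x => H (P x) (x m)) (fun p => W p i)).
  + move=> j jd; apply: (cont_at_homotopy cx HC) => //; last exact: cont_at_coord.
    * by move=> l ld; apply: contr_cube_succ => //; apply: PC.
    * by move=> q /cm /PX.
  + by move=> q cq; apply: HY; [apply: PX; apply: cm|apply: cmm].
  by apply: WC => //; apply: HY; [apply: PX; apply: cm|apply: cmm].
by rewrite (pP x y).
Qed.

Lemma contr_comp_cube m d (X : subspace) (P : Rd -> Rd) (k : Rd -> R) :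
  (forall x, cube m x -> X (P x)) ->
  (forall i, (i < d)%N -> contr m (cube m) (fun x => P x i)) ->
  contr d X k -> contr m (cube m) (fun x => k (P x)).
Proof.
move=> PX PC Ck x cx; apply: (@cont_at_comp _ _ d X P) => // [i id|]; first exact: PC.
by apply: Ck; apply: PX.
Qed.

(** * The contradiction from a homotopy equivalence *)

Section NotEquivalent.
Variables (n : nat) (f g : Rd -> Rd).
Hypotheses (n0 : (0 < n)%N).
Let d := dimS2 n.
Hypotheses (fM : is_map d (S0 n) (S1 n) f) (gM : is_map d (S1 n) (S0 n) g).
Hypothesis gf : homotopic d (S0 n) (S0 n) (fun p => g (f p)) (fun p => p).
Hypothesis fg : homotopic d (S1 n) (S1 n) (fun p => f (g p)) (fun p => p).

Let h p := retract n 0 (f p).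

Let h_sph p : S0 n p -> sph n (h p).
Proof. by move=> Sp; apply: retract0_sph; apply: fM.1. Qed.

Let h_contr i : (i < n.+1)%N -> contr d (S0 n) (fun p => h p i).
Proof.
move=> im p Sp; apply: (@cont_at_comp _ _ d (S1 n) f (fun p => retract n 0 p i)).
- by move=> j jd; apply: (continuous_on_coord fM.2 jd).
- exact: fM.1.
by apply: contr_retract => //; [apply: dim_fst|apply: fM.1].
Qed.

Let join (b : bool) j u v := if b then pair n j.+1 v u else pair n j.+1 u v.

Let join_S0 b j u v : sph n u -> sph n v -> S0 n (join b j u v).
Proof. by case: b => su sv; apply: pair_S0. Qed.

Let cont_at_join b j e (P : subspace) u v p i :
  (forall i, (i < n.+1)%N -> cont_at e P (fun q => u q i) p) ->
  (forall i, (i < n.+1)%N -> cont_at e P (fun q => v q i) p) ->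
  cont_at e P (fun q => join b j (u q) (v q) i) p.
Proof. by case: b => Cu Cv; apply: cont_at_pair. Qed.

Let join_bimap b j : bimap n (fun u v => h (join b j u v)).
Proof.
split=> [u v su sv|e P u v p i S Pp Cu Cv im]; first by apply: h_sph; apply: join_S0.
apply: (@cont_at_comp _ _ d (S0 n) (fun q => join b j (u q) (v q)) (fun p => h p i)).
- by move=> k kd; apply: cont_at_join.
- by move=> q /S[]; apply: join_S0.
by apply: h_contr => //; have [] := S p Pp; apply: join_S0.
Qed.

(** The homotopy from [g f] to the identity replaces the second component [c], which is [w] of the
    joined point, by [w (g (f _))]. If the first component then sits at its test point,
    [retract0_eq] turns [f] into [h], and the second component is [w (g p)] with [p] that test
    point, which [tb] was chosen to avoid. *)
Let count_join_zero ta b j u v : 0 <= ta <= 1 -> smap n n u -> sph n v ->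
  eventually (fun M => count n M.*2.+1 (fun k x => sphK n ta (h (join b j (u x) v)) k) = false).
Proof.
move=> ta01; pose o := if b then 0%N else n.+1.
have od : o = 0%N \/ o = n.+1 by rewrite /o; case: (b); [left|right].
pose w := factor n j.+1 o.
have wS p : S0 n p -> sph n (w p) by move=> Sp; apply: factor_sph => //; apply: S0_S1.
have wC i : (i < n.+1)%N -> contr d (S0 n) (fun p => w p i).
  by move=> _; apply: contr_factor => //; apply: S0_S1.
have wJ u' v' : sph n u' -> sph n v' -> w (join b j u' v') = v'.
  move=> su sv; have [_ E1] := factor_pair j su sv; have [E2 _] := factor_pair j sv su.
  by rewrite /w /o /join; case: (b).
(* The test point for [ta] is unique by [sphK_center], so a single [tb] chosen at its image under
   [w g] suffices. *)
have [tb [tb01 Htb]] : exists tb, 0 <= tb <= 1 /\ forall p, sph n p ->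
    (forall k, (k < n)%N -> sphK n ta p k = 0) -> 0 < p 0%N ->
    ~ ((forall k, (k < n)%N -> sphK n tb (w (g p)) k = 0) /\ 0 < w (g p) 0%N).
  have [[p [sp Zp p0]]|N] := classic (exists p, [/\ sph n p,
      forall k, (k < n)%N -> sphK n ta p k = 0 & 0 < p 0%N]).
    have [tb [tb01 H]] := center_avoid n0 (wS (g p) (gM.1 p (or_introl sp))).
    exists tb; split=> // q sq Zq q0; by rewrite (sphK_center n0 sq sp Zq q0 Zp p0).
  by exists 0; split=> [|p sp Zp p0]; [lra|case: N; exists p].
move=> su sv; apply: (count_bimap_zero (B := fun u v => h (join b j u v)) (tb := tb)) => //.
move=> {u v su sv} u su; set c := fun x => collapse n (tail n x); move=> /=.
have sc : smap (n + n) n c := smap_tail _ (smap_collapse n).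
pose P x := join b j (u x) (c x).
have [uS uC pu] := su; have [cS cC pc] := sc.
have PS x : cube (n + n) x -> S0 n (P x) by move=> cx; apply: join_S0; [apply: uS|apply: cS].
have PC i : (i < d)%N -> contr (n + n) (cube (n + n)) (fun x => P x i).
  by move=> _ x cx; apply: cont_at_join => k kn; [apply: uC|apply: cC].
have pP : periodic (n + n) P by move=> x y cx cy xy; rewrite /P (pu x y) // (pc x y).
have shP : smap (n + n) n (fun x => h (P x)).
  split=> [x cx|i im|x y cx cy xy]; last by rewrite (pP x y).
    by apply: h_sph; apply: PS.
  exact: contr_comp_cube PS PC (h_contr im).
have [H [HY [HC HE]]] := gf.
have H0 p : S0 n p -> H p 0 = g (f p).
  by move=> Sp; apply: functional_extensionality => i; case: (HE p Sp i).
have H1 p : S0 n p -> H p 1 = p.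
  by move=> Sp; apply: functional_extensionality => i; case: (HE p Sp i).
have hw : shom (n + n) n (fun t x => w (H (P x) t)) by apply: (shom_homotopy HY HC wS wC PS PC pP).
have E := count_pair_homotopy n0 (smap_shom shP) hw ta01 tb01 ta01 tb01.
have zero01 : 0 <= 0 <= 1 by lra.
have av := @count_pair_avoid n (fun x => h (P x)) (fun x => w (H (P x) 0)) ta tb shP (shom_smap zero01 hw).
apply: eventually_mono (eventually_and E (av _)) => [N [E1 E2]|x cx Z1 x1 Z2 x2].
  rewrite -E2 E1; apply: eq_count => k x _ cx; rewrite (H1 _ (PS x cx)) /P wJ //; [exact: uS|exact: cS].
have Sf := fM.1 _ (PS x cx); have x1' : 0 < h (P x) 0%N by lra.
have fE := retract0_eq Sf x1'.
move: Z2 x2; rewrite (H0 _ (PS x cx)) -fE => Z2 x2.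
apply: (Htb (h (P x))) => //; first by apply: h_sph; apply: PS.
by split=> //; rewrite /h; lra.
Qed.

Lemma no_equivalence : False.
Proof.
set c := collapse n; have [cS cC pc] := smap_collapse n.
have cS1 x : S1 n (c x) by left; apply: collapse_sph.
have c0 i x : (n < i)%N -> c x i = 0.
  by move=> ni; have [s _] := proj1 (sphE n (c x)) (collapse_sph n x); apply: s.
have cC' i : (i < d)%N -> contr n (cube n) (fun x => c x i).
  move=> _; have [im|im] := ltnP i n.+1; first exact: cC.
  move=> x cx; apply: (cont_at_ext (k' := fun=> 0)) => // [q _|]; first by rewrite c0.
  exact: cont_at_const.
pose a x := g (c x).
have aS x : cube n x -> S0 n (a x) by move=> _; apply: gM.1.
have aC i : (i < d)%N -> contr n (cube n) (fun x => a x i).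
  move=> id; apply: (contr_comp_cube (X := S1 n) (P := c) (k := fun p => g p i) _ cC') => //.
  exact: continuous_on_coord gM.2 id.
have pa : periodic n a by move=> x y cx cy xy; rewrite /a /c (pc x y).
have o0 : S0 n (fun=> 0) by apply/S0_piece; exists 0%N; apply: piece_zero.
(* This [ta] keeps the image of the base point of [S0] under [h] off the test point, as
   [count_wedge] requires. *)
have [ta [ta01 nc]] := center_avoid n0 (h_sph o0).
have Z : eventually (fun M => count n M.*2.+1 (fun k x => sphK n ta (h (a x)) k) = false).
  apply: count_wedge => // j.
  pose a1 x := factor n j.+1 0 (a x); pose a2 x := factor n j.+1 n.+1 (a x).
  have sF o : o = 0%N \/ o = n.+1 -> smap n n (fun x => factor n j.+1 o (a x)).
    move=> od; split=> [x cx|i im|x y cx cy xy]; last by rewrite (pa x y).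
      by apply: factor_sph => //; apply: S0_S1; apply: aS.
    by apply: (contr_comp_cube (k := fun p => factor n j.+1 o p i) aS aC); apply: contr_factor => //; apply: S0_S1.
  have s1 : smap n n a1 by apply: sF; left.
  have s2 : smap n n a2 by apply: sF; right.
  have cz : cube n (fun=> 0) by move=> i _; lra.
  have su : sph n (a1 (fun=> 0)) by case: s1 => S _ _; apply: S.
  have sv : sph n (a2 (fun=> 0)) by case: s2 => S _ _; apply: S.
  have P := @count_pinch n (fun u v => h (join false j u v)) ta a1 a2 _ _ n0 (join_bimap false j)
    ta01 s1 s2 su sv.
  apply: eventually_mono (P _ _ _) => [M <-|x cx x0|u su'|v sv'].
  - by apply: eq_count => k x _ cx; rewrite retract_pair //; apply: aS.
  (* The collapse sends both faces of coordinate 0 to the base point, so [a] is constant there, as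
     pinching requires. *)
  - have E : a x = a (fun=> 0).
      rewrite /a /c !(@collapse_boundary n _ 0%N) //; first by ring.
      by case: x0 => ->; ring.
    by rewrite /a1 /a2 E.
  - exact: (count_join_zero false j ta01 su' sv).
  exact: (count_join_zero true j ta01 sv' su).
have [H [HY [HC HE]]] := fg.
have hw : shom n n (fun t x => retract n 0 (H (c x) t)).
  apply: (shom_homotopy HY HC) => //; first exact: retract0_sph.
  by move=> i im; apply: contr_retract => //; apply: dim_fst.
have zero01 : 0 <= 0 <= 1 by lra.
have E1 := eventually_odd (count_sph_homotopy n0 hw ta01 ta01).
(* The degree of the collapse is known for parameter 0, whereas the vanishing [Z] holds for [ta];
   this compares the two. *)
have E2 := eventually_odd (count_sph_tau n0 (smap_collapse n) ta01 zero01).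
have [N0 HN] := eventually_and (eventually_and Z E1) (eventually_and E2 (count_collapse n0)).
have [[F1 F2] [F3 F4]] := HN N0 (leqnn N0).
have H0 p : S1 n p -> H p 0 = f (g p).
  by move=> Sp; apply: functional_extensionality => i; case: (HE p Sp i).
have H1 p : S1 n p -> H p 1 = p.
  by move=> Sp; apply: functional_extensionality => i; case: (HE p Sp i).
move: F4; rewrite -F3.
rewrite (@eq_count n _ _ (fun k x => sphK n ta (retract n 0 (H (c x) 1)) k)); last first.
  move=> k x _ _; rewrite H1 // retract_on //; apply: sph_piece0; exact: collapse_sph.
rewrite -F2 (@eq_count n _ _ (fun k x => sphK n ta (h (a x)) k)) ?F1 //.
by move=> k x _ _; rewrite H0.
Qed.

End NotEquivalent.

Lemma not_homotopy_equivalent_S0_S1 n : (0 < n)%N ->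
  ~ homotopy_equivalent (dimS2 n) (S0 n) (S1 n).
Proof. by move=> n0 [f [g [fM [gM [gf fg]]]]]; apply: (no_equivalence n0 fM gM gf fg). Qed.

End Degree.

Theorem theorem3p8 (n : nat) (hn : (2 <= n)%nat) :
  h_equal (dimS2 n) (S0 n) (S1 n) /\ ~ homotopy_equivalent (dimS2 n) (S0 n) (S1 n).
Proof.
split; [apply Degree.h_equal_S0_S1|].
apply Degree.not_homotopy_equivalent_S0_S1, (ssrbool.introT ssrnat.ltP); lia.
Qed.
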